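(* Let $(A,B)$ satisfy (1.1)-(1.4) of the context. Any cost $c\in\mathcal{C}_{LQ}$ is equivalent to a canonical cost $\tilde c(t,x,u)=(u+K(t)x)^\top R(t)(u+K(t)x)$. Moreover, the mapping $K_+$ associated with $\tilde c$ is $K_+=K$ (equivalently, the mapping $A_+$ associated with $\tilde c$ is $A_+=A-BK$).
   Context: Notation: $M_{n,m}(\mathbb{R})$ denotes real $n\times m$ matrices, $M_n(\mathbb{R})=M_{n,n}(\mathbb{R})$, $\mathrm{Sym}(n)$ the symmetric matrices in $M_n(\mathbb{R})$; $Q_1\succ Q_2$ means $Q_1-Q_2$ is positive definite. $\Phi_A(t,\tau)$ is the transition matrix: $\partial_t\Phi_A(t,\tau)=A(t)\Phi_A(t,\tau)$, $\Phi_A(\tau,\tau)=I$. $A$ is exponentially stable if there are $\alpha,\beta>0$ with $\|\Phi_A(t,t_0)\|\le\alpha e^{-\beta(t-t_0)}$ for all $t\ge t_0$. Assumptions on $(A,B)$: (1.1) $A:\mathbb{R}\to M_n(\mathbb{R})$ and $B:\mathbb{R}\to M_{n,m}(\mathbb{R})$ are $C^\infty$ and bounded; (1.2) $B(t)$ is injective for every $t$; (1.3) for every $t$, $\mathrm{span}\{B_i(t)v: v\in\mathbb{R}^m, i\in\mathbb{N}\}=\mathbb{R}^n$, where $B_0=B$, $B_{i+1}=\dot B_i-AB_i$; (1.4) there are constants $s,\beta>0$ such that for every $t$, $\int_t^{t+s}\Phi_A(t,\tau)B(\tau)B(\tau)^\top\Phi_A(t,\tau)^\top d\tau\succ\beta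 I$. $\mathcal{C}_{LQ}$ is the set of quadratic costs $c(t,x,u)=x^\top Q(t)x+2x^\top S(t)u+u^\top R(t)u$ such that: $Q:\mathbb{R}\to\mathrm{Sym}(n)$, $S:\mathbb{R}\to M_{n,m}(\mathbb{R})$, $R:\mathbb{R}\to\mathrm{Sym}(m)$ are smooth and bounded; there is $\alpha>0$ with $R(t)\succ\alpha I$ for all $t$; and $Q(t)-S(t)R(t)^{-1}S(t)^\top$ is positive semidefinite for all $t$. The optimal synthesis of $c$ is the set of all trajectories, for all data $t_0<t_1$, $x_0,x_1\in\mathbb{R}^n$, minimizing $\int_{t_0}^{t_1}c(t,x_u(t),u(t))\,dt$ among trajectories $x_u$ of $\dot x=A(t)x+B(t)u$ with $x_u(t_0)=x_0$, $x_u(t_1)=x_1$ (square-integrable controls may be taken). Two costs in $\mathcal{C}_{LQ}$ are equivalent if they have the same optimal synthesis (for the fixed $(A,B)$). For a cost given by $(Q,S,R)$, $P_+:\mathbb{R}\to\mathrm{Sym}(n)$ is the unique solution of the Riccati equation $\dot P=-PA-A^\top P+(PB+S)R^{-1}(B^\top P+S^\top)-Q$ such that $A_+=A-BR^{-1}(S^\top+B^\top P_+)$ is exponentially stable; $K_+=R^{-1}(S^\top+B^\top P_+)$, so $A_+=A-BK_+$. A canonical cost is a cost $(u+K(t)x)^\top R(t)(u+K(t)x)$ where $R:\mathbb{R}\to\mathrm{Sym}(m)$ is smooth, bounded, uniformly positive definite ($R(t)\succ\alpha I$ for some $\alpha>0$ and all $t$) with $\det R(0)=1$, and $K:\mathbb{R}\to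 M_{m,n}(\mathbb{R})$ is smooth, bounded, with $A-BK$ exponentially stable. It corresponds to $Q=K^\top RK$, $S=K^\top R$, and belongs to $\mathcal{C}_{LQ}$.
   Formalization: The formal theorem also assumes that the Riccati equation of c has a symmetric solution with A_+ exponentially stable (P_+ exists), as the context presupposes; without it the claim fails for n=m=1, A=0, B=1, c=u^2. *)

(* Defs.v *)
From HB Require Import structures.
From mathcomp Require Import all_boot all_order all_algebra.
From mathcomp Require Import all_classical all_reals all_analysis.

Set Implicit Arguments.
Unset Strict Implicit.
Unset Printing Implicit Defensive.

Import Order.TTheory GRing.Theory Num.Theory.
Import numFieldNormedType.Exports.

Local Open Scope classical_set_scope.
Local Open Scope ring_scope.

(* Vectors of R^n are columns; matrix norms are the library's max norm, which is
   equivalent to any other norm. *)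

Section Matrices.
Context {R : realType}.

Definition quad n (M : 'M[R]_n) (x : 'cV[R]_n) : R := (x^T *m M *m x) 0 0.

Definition sym n (M : 'M[R]_n) : Prop := M^T = M.

Definition posdef n (M : 'M[R]_n) : Prop :=
  sym M /\ forall x : 'cV[R]_n, x != 0 -> 0 < quad M x.

Definition possemidef n (M : 'M[R]_n) : Prop :=
  sym M /\ forall x : 'cV[R]_n, 0 <= quad M x.

Definition loewner_gt n (M N : 'M[R]_n) : Prop := posdef (M - N).

Definition lin_span n (X : set 'cV[R]_n) : set 'cV[R]_n :=
  [set x | exists (N : nat) (a : 'I_N -> R) (v : 'I_N -> 'cV[R]_n),
     (forall k, X (v k)) /\ x = \sum_(k < N) a k *: v k].

Definition mx_integral p q (D : set R) (F : R -> 'M[R]_(p, q)) : 'M[R]_(p, q) :=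
  \matrix_(i, j) Rintegral (@lebesgue_measure R) D (fun t => F t i j).

Definition smooth p q (F : R -> 'M[R]_(p, q)) : Prop :=
  forall (k : nat) (t : R), derivable (derive1n k F) t 1.

Definition unif_posdef p (W : R -> 'M[R]_p) : Prop :=
  exists2 alpha : R, 0 < alpha & forall t, loewner_gt (W t) alpha%:M.

End Matrices.

Section LinearSystem.
Context {R : realType} {n m : nat}.

Definition transition_matrix (A : R -> 'M[R]_n) (Phi : R -> R -> 'M[R]_n) : Prop :=
  (forall tau, Phi tau tau = 1%:M) /\
  (forall t tau : R, is_derive t (1 : R) (fun r => Phi r tau) (A t *m Phi t tau)).

Definition exp_stable (A : R -> 'M[R]_n) : Prop :=
  exists Phi, transition_matrix A Phi /\
  exists alpha beta : R, [/\ 0 < alpha, 0 < beta &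
    forall t0 t, t0 <= t -> `|Phi t t0| <= alpha * expR (- beta * (t - t0))].

Variables (A : R -> 'M[R]_n) (B : R -> 'M[R]_(n, m)).

Fixpoint bracket (i : nat) : R -> 'M[R]_(n, m) :=
  if i is j.+1 then fun t => derive1 (bracket j) t - A t *m bracket j t else B.

Definition unif_controllable : Prop :=
  exists Phi, transition_matrix A Phi /\
  exists s beta : R, [/\ 0 < s, 0 < beta &
    forall t, loewner_gt
      (mx_integral `[t, t + s]
         (fun tau => Phi t tau *m B tau *m (B tau)^T *m (Phi t tau)^T))
      beta%:M].

Record standing_assumptions : Prop := {
  A_smooth : smooth A;
  A_bounded : bounded_fun A;
  B_smooth : smooth B;
  B_bounded : bounded_fun B;
  B_injective : forall t, injective (fun v : 'cV[R]_m => B t *m v);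
  AB_bracket_generating : forall t,
    lin_span [set w | exists i (v : 'cV[R]_m), w = bracket i t *m v] = setT;
  AB_unif_controllable : unif_controllable
}.

Definition square_integrable (t0 t1 : R) (u : R -> 'cV[R]_m) : Prop :=
  forall i, measurable_fun `[t0, t1] (fun t => u t i 0) /\
    (@lebesgue_measure R).-integrable `[t0, t1] (fun t => (u t i 0 ^+ 2)%:E).

(* Caratheodory solutions of x' = A x + B u on [t0, t1], in integral form; the
   values of x and u outside [t0, t1] play no role. *)
Definition trajectory (t0 t1 : R) (x : R -> 'cV[R]_n) (u : R -> 'cV[R]_m) : Prop :=
  [/\ square_integrable t0 t1 u, {within `[t0, t1], continuous x} &
      forall t, t0 <= t <= t1 ->
        x t = x t0 + mx_integral `[t0, t] (fun r => A r *m x r + B r *m u r)].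

Definition cost_integral (c : R -> 'cV[R]_n -> 'cV[R]_m -> R) (t0 t1 : R)
    (x : R -> 'cV[R]_n) (u : R -> 'cV[R]_m) : R :=
  Rintegral (@lebesgue_measure R) `[t0, t1] (fun t => c t (x t) (u t)).

Definition minimizing (c : R -> 'cV[R]_n -> 'cV[R]_m -> R) (t0 t1 : R)
    (x : R -> 'cV[R]_n) (u : R -> 'cV[R]_m) : Prop :=
  trajectory t0 t1 x u /\
  forall y v, trajectory t0 t1 y v -> y t0 = x t0 -> y t1 = x t1 ->
    cost_integral c t0 t1 x u <= cost_integral c t0 t1 y v.

(* A trajectory on [t0, t1] is represented by all its extensions to R, so that
   equality of syntheses only depends on the restrictions to [t0, t1]. *)
Definition optimal_synthesis (c : R -> 'cV[R]_n -> 'cV[R]_m -> R) :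
    set (R * R * (R -> 'cV[R]_n)) :=
  [set z | z.1.1 < z.1.2 /\ exists u, minimizing c z.1.1 z.1.2 z.2 u].

Definition equivalent_costs (c1 c2 : R -> 'cV[R]_n -> 'cV[R]_m -> R) : Prop :=
  optimal_synthesis c1 = optimal_synthesis c2.

Definition lq_cost (Q : R -> 'M[R]_n) (S : R -> 'M[R]_(n, m)) (W : R -> 'M[R]_m)
    (t : R) (x : 'cV[R]_n) (u : 'cV[R]_m) : R :=
  quad (Q t) x + 2 * (x^T *m S t *m u) 0 0 + quad (W t) u.

(* The weight matrix of the control, usually called R, is called W. *)
Record C_LQ (Q : R -> 'M[R]_n) (S : R -> 'M[R]_(n, m)) (W : R -> 'M[R]_m) :
    Prop := {
  Q_sym : forall t, sym (Q t);
  W_sym : forall t, sym (W t);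
  Q_smooth : smooth Q;
  S_smooth : smooth S;
  W_smooth : smooth W;
  Q_bounded : bounded_fun Q;
  S_bounded : bounded_fun S;
  W_bounded : bounded_fun W;
  W_unif_posdef : unif_posdef W;
  QSW_possemidef : forall t, possemidef (Q t - S t *m invmx (W t) *m (S t)^T)
}.

(* Equal to K_+ and, for closed_loop, to A_+ when P = P_+. *)
Definition riccati_gain (S : R -> 'M[R]_(n, m)) (W : R -> 'M[R]_m) (P : R -> 'M[R]_n)
    (t : R) : 'M[R]_(m, n) :=
  invmx (W t) *m ((S t)^T + (B t)^T *m P t).

Definition closed_loop (S : R -> 'M[R]_(n, m)) (W : R -> 'M[R]_m) (P : R -> 'M[R]_n)
    (t : R) : 'M[R]_n :=
  A t - B t *m riccati_gain S W P t.

Definition riccati (Q : R -> 'M[R]_n) (S : R -> 'M[R]_(n, m)) (W : R -> 'M[R]_m)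
    (P : R -> 'M[R]_n) : Prop :=
  forall t : R, is_derive t (1 : R) P
    (- (P t *m A t) - (A t)^T *m P t
     + (P t *m B t + S t) *m invmx (W t) *m ((B t)^T *m P t + (S t)^T)
     - Q t).

(* Membership in C_LQ does not ensure that a stabilizing solution exists: for
   n = m = 1, A = 0, B = 1, c = u^2 the equation is P' = P^2, whose only global
   solution P = 0 gives the closed loop 0. Uniqueness, when one exists, holds
   without a boundedness requirement on P. *)
Definition stabilizing_solution (Q : R -> 'M[R]_n) (S : R -> 'M[R]_(n, m))
    (W : R -> 'M[R]_m) (P : R -> 'M[R]_n) : Prop :=
  [/\ forall t, sym (P t), riccati Q S W P & exp_stable (closed_loop S W P)].

(* unique also asserts that P is a stabilizing solution. *)
Definition is_P_plus (Q : R -> 'M[R]_n) (S : R -> 'M[R]_(n, m))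
    (W : R -> 'M[R]_m) (P : R -> 'M[R]_n) : Prop :=
  unique (stabilizing_solution Q S W) P.

Record canonical_pair (K : R -> 'M[R]_(m, n)) (W : R -> 'M[R]_m) : Prop := {
  canonical_W_sym : forall t, sym (W t);
  canonical_W_smooth : smooth W;
  canonical_W_bounded : bounded_fun W;
  canonical_W_unif_posdef : unif_posdef W;
  canonical_W_det0 : \det (W 0) = 1;
  canonical_K_smooth : smooth K;
  canonical_K_bounded : bounded_fun K;
  canonical_stable : exp_stable (fun t => A t - B t *m K t)
}.

Definition canonical_cost (K : R -> 'M[R]_(m, n)) (W : R -> 'M[R]_m)
    (t : R) (x : 'cV[R]_n) (u : 'cV[R]_m) : R :=
  quad (W t) (u + K t *m x).

Definition canonical_Q (K : R -> 'M[R]_(m, n)) (W : R -> 'M[R]_m) (t : R) :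
  'M[R]_n := (K t)^T *m W t *m K t.

Definition canonical_S (K : R -> 'M[R]_(m, n)) (W : R -> 'M[R]_m) (t : R) :
  'M[R]_(n, m) := (K t)^T *m W t.

End LinearSystem.

(* Main.v *)
(* Let P be the stabilizing solution and K its gain. Completing the square, the
   cost and the quadratic form W evaluated at u + K x differ along every
   trajectory by the derivative of x^T P x, whose integral only depends on the
   end points, so both have the same minimizers; scaling W by a positive constant
   normalizes the determinant at 0.
   K is bounded because P is: as W is positive, x^T P x decreases at most at the
   rate of the cost, and by uniform controllability any x0 can be steered to 0, and
   0 to any x0, in a fixed time with cost at most a constant times |x0|^2, which
   bounds x0^T P x0 from above, respectively from below.
   For the canonical cost 0 is a stabilizing solution with gain K. If P is another
   one, then Phi_1(t, s)^T P(t) Phi_2(t, s) is independent of t, where Phi_1 and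
   Phi_2 are the two closed-loop flows; P is bounded and both flows decay, so this
   constant, which is P(s), vanishes. *)

Require Import Defs.
From mathcomp Require Import all_boot all_order all_algebra.
From mathcomp Require Import all_classical all_reals all_analysis.
From mathcomp Require Import measurable_realfun ring lra.

Set Implicit Arguments.
Unset Strict Implicit.
Unset Printing Implicit Defensive.

Import Order.TTheory GRing.Theory Num.Theory.
Import numFieldNormedType.Exports.

Local Open Scope classical_set_scope.
Local Open Scope ring_scope.

(** * Calculus of matrix-valued functions *)

Section MatrixCalculus.
Context {R : realType}.

Lemma is_derive_mxP p q (F : R -> 'M[R]_(p, q)) (t : R) (D : 'M[R]_(p, q)) :
  is_derive t 1 F D <-> forall i j, is_derive t 1 (fun r => F r i j) (D i j).
Proof.
split=> [dF i j|dF].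
- have dFij : derivable (fun r => F r i j) t 1.
    by move: i j; apply/derivable_mxP; exact: ex_derive.
  apply: DeriveDef => //.
  by case: dF => dF <-; rewrite derive_mx ?mxE.
- have dM : derivable F t 1 by apply/derivable_mxP => i j; exact: ex_derive.
  apply: DeriveDef => //; rewrite derive_mx //.
  by apply/matrixP => i j; rewrite mxE; exact: derive_val.
Qed.

Lemma is_derive_unique {V : normedModType R} (F : R -> V) (t : R) (D D' : V) :
  is_derive t 1 F D -> is_derive t 1 F D' -> D = D'.
Proof. by case=> _ <- [_ <-]. Qed.

Lemma is_derive_eq_fun {V : normedModType R} (F G : R -> V) (t : R) (D D' : V) :
  F =1 G -> D = D' -> is_derive t 1 F D -> is_derive t 1 G D'.
Proof. by move=> /funext -> ->. Qed.

Lemma is_derive_sumr I (s : seq I) (F : I -> R -> R) (t : R) (D : I -> R) :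
  (forall i, is_derive t 1 (F i) (D i)) ->
  is_derive t 1 (fun r => \sum_(i <- s) F i r) (\sum_(i <- s) D i).
Proof.
move=> dF; elim: s => [|i s IHs].
  by apply: is_derive_eq_fun (is_derive_cst 0 t 1) => [r|]; rewrite big_nil.
by apply: is_derive_eq_fun (is_deriveD (dF i) IHs) => [r|]; rewrite big_cons.
Qed.

Lemma is_derive_mulr (f g : R -> R) (t df dg : R) :
  is_derive t 1 f df -> is_derive t 1 g dg ->
  is_derive t 1 (fun r => f r * g r) (df * g t + f t * dg).
Proof.
move=> hf hg; apply: is_derive_eq_fun (is_deriveM hf hg) => //.
by rewrite /GRing.scale /= addrC [g t * _]mulrC.
Qed.

Lemma is_derive_mulmx p q s (F : R -> 'M[R]_(p, q)) (G : R -> 'M[R]_(q, s))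
    (t : R) dF dG :
  is_derive t 1 F dF -> is_derive t 1 G dG ->
  is_derive t 1 (fun r => F r *m G r) (dF *m G t + F t *m dG).
Proof.
move=> /is_derive_mxP hF /is_derive_mxP hG; apply/is_derive_mxP => i j.
have h : is_derive t 1 (fun r => \sum_k F r i k * G r k j)
    (\sum_k (dF i k * G t k j + F t i k * dG k j)).
  by apply: is_derive_sumr => k; exact: is_derive_mulr.
by apply: is_derive_eq_fun h => [r|]; rewrite ?big_split !mxE.
Qed.

Lemma is_derive_addmx p q (F G : R -> 'M[R]_(p, q)) (t : R) dF dG :
  is_derive t 1 F dF -> is_derive t 1 G dG ->
  is_derive t 1 (fun r => F r + G r) (dF + dG).
Proof. by move=> hF hG; exact: is_deriveD. Qed.

Lemma is_derive_subr {V : normedModType R} (F G : R -> V) (t : R) dF dG :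
  is_derive t 1 F dF -> is_derive t 1 G dG ->
  is_derive t 1 (fun r => F r - G r) (dF - dG).
Proof. by move=> hF hG; exact: is_deriveB. Qed.

Lemma is_derive_trmx p q (F : R -> 'M[R]_(p, q)) (t : R) dF :
  is_derive t 1 F dF -> is_derive t 1 (fun r => (F r)^T) dF^T.
Proof.
move=> /is_derive_mxP hF; apply/is_derive_mxP => i j; rewrite mxE.
by apply: is_derive_eq_fun (hF j i) => // r; rewrite mxE.
Qed.

Lemma derivable_prodr I (s : seq I) (F : I -> R -> R) (t : R) :
  (forall i, derivable (F i) t 1) ->
  derivable (fun r => \prod_(i <- s) F i r) t 1.
Proof.
move=> dF; elim: s => [|i s IHs].
  rewrite (_ : (fun _ => _) = cst 1); last by apply/funext => r; rewrite big_nil.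
  exact: derivable_cst.
rewrite (_ : (fun _ => _) = F i * (fun r => \prod_(i <- s) F i r)).
  exact: derivableM.
by apply/funext => r; rewrite big_cons.
Qed.

Lemma derivable_sumr I (s : seq I) (F : I -> R -> R) (t : R) :
  (forall i, derivable (F i) t 1) ->
  derivable (fun r => \sum_(i <- s) F i r) t 1.
Proof.
move=> dF; apply: ex_derive; apply: (@is_derive_sumr I s F t (fun i => 'D_1 (F i) t)).
by move=> i; apply/derivableP.
Qed.

Lemma derivable_cstM (c : R) (f : R -> R) (t : R) :
  derivable f t 1 -> derivable (fun r => c * f r) t 1.
Proof. by move=> df; apply: (derivableM _ df); exact: derivable_cst. Qed.

Lemma derivable_det p (M : R -> 'M[R]_p) (t : R) :
  (forall i j, derivable (fun r => M r i j) t 1) ->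
  derivable (fun r => \det (M r)) t 1.
Proof.
move=> dM; rewrite /determinant; apply: derivable_sumr => s.
by apply: derivable_cstM; exact: derivable_prodr.
Qed.

(** Cramer's rule writes each entry as a cofactor divided by the determinant, and determinants are
    polynomial in the entries. Invertibility at every [r] makes this an equality of functions, since
    [invmx] returns its argument on singular matrices. *)
Lemma derivable_invmx p (M : R -> 'M[R]_p) (t : R) :
  (forall r, M r \in unitmx) -> derivable M t 1 ->
  derivable (fun r => invmx (M r)) t 1.
Proof.
move=> uM /derivable_mxP dM; apply/derivable_mxP => i j.
rewrite (_ : (fun _ => _) =
  (fun r => (\det (M r))^-1) * (fun r => cofactor (M r) j i)); last first.
  by apply/funext => r; rewrite /invmx uM !mxE.
apply: derivableM.
  apply: derivableV; first by rewrite -unitfE -unitmxE.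
  exact: derivable_det.
apply: derivable_cstM; apply: derivable_det => k l.
rewrite (_ : (fun _ => _) = fun r => M r (lift j k) (lift i l)) //.
by apply/funext => r; rewrite !mxE.
Qed.

(** Once the inverse is known to be differentiable, its derivative is found by differentiating the
    constant product [invmx (M r) *m M r] and solving for the unknown factor. *)
Lemma is_derive_invmx p (M : R -> 'M[R]_p) (t : R) dM :
  (forall r, M r \in unitmx) -> is_derive t 1 M dM ->
  is_derive t 1 (fun r => invmx (M r)) (- (invmx (M t) *m dM *m invmx (M t))).
Proof.
move=> uM hM; have dV : derivable (fun r => invmx (M r)) t 1.
  by apply: derivable_invmx => //; exact: ex_derive.
have hV : is_derive t 1 (fun r => invmx (M r)) ('D_1 (fun r => invmx (M r)) t).
  exact/derivableP.
suff <- : 'D_1 (fun r => invmx (M r)) t = - (invmx (M t) *m dM *m invmx (M t)) by [].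
have h1 := is_derive_mulmx hV hM.
have h0 : is_derive t 1 (fun r => invmx (M r) *m M r) 0.
  rewrite (_ : (fun _ => _) = cst 1%:M); first exact: is_derive_cst.
  by apply/funext => r; rewrite mulVmx.
move/eqP: (is_derive_unique h1 h0); rewrite addr_eq0 => /eqP h.
by rewrite -[LHS](mulmxK (uM t)) h mulNmx.
Qed.

Lemma is_derive_continuous {V : normedModType R} (F : R -> V) (t : R) dF :
  is_derive t 1 F dF -> {for t, continuous F}.
Proof. by move=> hF; apply/differentiable_continuous/derivable1_diffP/ex_derive. Qed.

Lemma derivable_entry p q (F : R -> 'M[R]_(p, q)) (t : R) i j :
  derivable F t 1 -> derivable (fun r => F r i j) t 1.
Proof. by move/derivable_mxP. Qed.

End MatrixCalculus.

(** * Norm estimates and positive definite matrices *)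

Section MatrixBounds.
Context {R : realType}.

Lemma ler_mx_norm p q (M : 'M[R]_(p, q)) i j : `|M i j| <= `|M|.
Proof.
rewrite [leRHS]/Num.Def.normr /= mx_normrE.
exact: (@le_bigmax _ _ _ 0 (fun ij => `|M ij.1 ij.2|) (i, j)).
Qed.

Lemma mx_norm_ler p q (M : 'M[R]_(p, q)) (c : R) :
  0 <= c -> (forall i j, `|M i j| <= c) -> `|M| <= c.
Proof.
move=> c0 Mc; rewrite [leLHS]/Num.Def.normr /= mx_normrE.
by apply: bigmax_le => // -[i j].
Qed.

Lemma normr_mulmx p q s (X : 'M[R]_(p, q)) (Y : 'M[R]_(q, s)) :
  `|X *m Y| <= q%:R * (`|X| * `|Y|).
Proof.
apply: mx_norm_ler => [|i j]; first by rewrite !mulr_ge0.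
rewrite mxE; apply: (le_trans (ler_norm_sum _ _ _)).
rewrite -[X in X%:R * _]card_ord mulr_natl -sumr_const.
by apply: ler_sum => k _; rewrite normrM ler_pM // ler_mx_norm.
Qed.

Lemma mulmx_le p q s (X : 'M[R]_(p, q)) (Y : 'M[R]_(q, s)) (a b : R) :
  `|X| <= a -> `|Y| <= b -> `|X *m Y| <= q%:R * (a * b).
Proof.
move=> Xa Yb; apply: (le_trans (normr_mulmx _ _)).
by rewrite ler_wpM2l // ler_pM.
Qed.

Lemma normr_trmx p q (X : 'M[R]_(p, q)) : `|X^T| = `|X|.
Proof.
have le (p' q' : nat) (Y : 'M[R]_(p', q')) : `|Y^T| <= `|Y|.
  by apply: mx_norm_ler => // i j; rewrite mxE ler_mx_norm.
by apply/eqP; rewrite eq_le le -{1}[X]trmxK le.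
Qed.

Lemma bounded_funE p q (F : R -> 'M[R]_(p, q)) :
  bounded_fun F <-> exists2 c : R, 0 <= c & forall t, `|F t| <= c.
Proof.
have PF : ProperFilter (globally [set: R]) := globally_properfilter (I : setT (0 : R)).
split=> [|[c _ Fc]]; last by apply/ex_bound; exists c => t _; exact: Fc.
move=> /= /ex_bound[c Fc]; exists `|c| => // t; apply: le_trans (ler_norm _); exact: Fc.
Qed.

(** Energy estimates need a differentiable quantity, which the max norm is not; [ler_dotp] and
    [norm_sq_le_dotp] compare this inner product with the max norm. *)
Definition dotp p (x y : 'cV[R]_p) : R := (x^T *m y) 0 0.

Lemma dotpE p (x y : 'cV[R]_p) : dotp x y = \sum_i x i 0 * y i 0.
Proof. by rewrite /dotp mxE; apply: eq_bigr => i _; rewrite mxE. Qed.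

Lemma dotp_ge0 p (x : 'cV[R]_p) : 0 <= dotp x x.
Proof. by rewrite dotpE sumr_ge0 // => i _; rewrite -expr2 sqr_ge0. Qed.

Lemma ler_dotp p (x y : 'cV[R]_p) : `|dotp x y| <= p%:R * (`|x| * `|y|).
Proof.
apply: (le_trans (ler_mx_norm _ _ _)); apply: mulmx_le => //.
by rewrite normr_trmx.
Qed.

Lemma norm_sq_le_dotp p (x : 'cV[R]_p) : `|x| ^+ 2 <= dotp x x.
Proof.
have x2 i : `|x i 0| ^+ 2 <= dotp x x.
  rewrite dotpE (bigD1 i) //= -expr2 -normrX ger0_norm ?sqr_ge0 // lerDl.
  by apply: sumr_ge0 => k _; rewrite -expr2 sqr_ge0.
rewrite -[leRHS]sqr_sqrtr ?dotp_ge0 // ler_sqr ?nnegrE ?sqrtr_ge0 //.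
apply: mx_norm_ler => [|i j]; first exact: sqrtr_ge0.
rewrite (ord1 j) -(ger0_norm (sqrtr_ge0 _)) -ler_sqr ?nnegrE //.
by rewrite (ger0_norm (sqrtr_ge0 _)) sqr_sqrtr ?dotp_ge0.
Qed.

Lemma quadE p (M : 'M[R]_p) x : quad M x = dotp x (M *m x).
Proof. by rewrite /quad /dotp mulmxA. Qed.

(** A nonzero row vector in the left kernel would give a nonzero vector at which the quadratic form
    vanishes. *)
Lemma posdef_unitmx p (M : 'M[R]_p) : posdef M -> M \in unitmx.
Proof.
move=> [_ pM]; rewrite -row_free_unit -kermx_eq0; apply/negP => /negP.
move=> /rowV0Pn[u /sub_kermxP uM u0].
have : 0 < quad M u^T.
  by apply: pM; apply: contra_neq u0 => /(congr1 trmx); rewrite trmxK trmx0.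
by rewrite /quad trmxK uM mul0mx mxE ltxx.
Qed.

Lemma quadB p (M N : 'M[R]_p) x : quad (M - N) x = quad M x - quad N x.
Proof. by rewrite /quad mulmxBr mulmxBl !mxE. Qed.

Lemma quadD p (M N : 'M[R]_p) x : quad (M + N) x = quad M x + quad N x.
Proof. by rewrite /quad mulmxDr mulmxDl mxE. Qed.

Lemma quadZ p (M : 'M[R]_p) a x : quad (a *: M) x = a * quad M x.
Proof. by rewrite /quad -scalemxAr -scalemxAl mxE. Qed.

Lemma quad_scalar p (a : R) (x : 'cV[R]_p) : quad a%:M x = a * dotp x x.
Proof. by rewrite -scalemx1 quadZ quadE mul1mx. Qed.

Lemma dotp_gt0 p (x : 'cV[R]_p) : x != 0 -> 0 < dotp x x.
Proof.
by move=> x0; apply: lt_le_trans (norm_sq_le_dotp x); rewrite exprn_gt0 // normr_gt0.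
Qed.

Lemma loewner_gt_le p (M : 'M[R]_p) (b : R) x :
  loewner_gt M b%:M -> b * dotp x x <= quad M x.
Proof.
move=> [_ pM]; have [->|/pM] := eqVneq x 0.
  by rewrite quadE /dotp !mulmx0 !mxE mulr0.
by rewrite quadB quad_scalar subr_gt0 => /ltW.
Qed.

Lemma loewner_gt_posdef p (M : 'M[R]_p) (b : R) :
  0 <= b -> loewner_gt M b%:M -> posdef M.
Proof.
move=> b0 lM; case: (lM) => sM pM; split=> [|x x0].
  by move: sM; rewrite /sym linearB /= tr_scalar_mx => /addIr.
have := pM x x0; rewrite quadB subr_gt0; apply: le_lt_trans.
by rewrite quad_scalar mulr_ge0 // dotp_ge0.
Qed.

(** For [y = invmx M *m x], coercivity gives [b |y|^2 <= y^T M y = y^T x <= p |y| |x|], and one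
    factor [|y|] cancels. The factor [p] comes from bounding the inner product by max norms. *)
Lemma norm_invmx_mul p (M : 'M[R]_p) (b : R) (x : 'cV[R]_p) :
  0 < b -> loewner_gt M b%:M -> `|invmx M *m x| <= p%:R / b * `|x|.
Proof.
move=> b0 lM; have uM := posdef_unitmx (loewner_gt_posdef (ltW b0) lM).
set y := invmx M *m x.
have xE : x = M *m y by rewrite mulKVmx.
have [->|y0] := eqVneq y 0; first by rewrite normr0 mulr_ge0 // divr_ge0 // ltW.
have ny0 : 0 < `|y| by rewrite normr_gt0.
rewrite -(ler_pM2l ny0) -(ler_pM2l b0).
apply: (@le_trans _ _ (p%:R * (`|y| * `|x|))); last first.
  rewrite le_eqVlt; apply/orP; left; apply/eqP.
  by field; rewrite gt_eqF.
apply: le_trans (ler_dotp _ _); apply: le_trans (ler_norm _).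
rewrite {1}xE -quadE; apply: le_trans (loewner_gt_le y lM).
rewrite ler_wpM2l ?(ltW b0) // -expr2. exact: norm_sq_le_dotp.
Qed.

Lemma norm_invmx p (M : 'M[R]_p) (b : R) :
  0 < b -> loewner_gt M b%:M -> `|invmx M| <= p%:R / b.
Proof.
move=> b0 lM; have pb : 0 <= p%:R / b by rewrite divr_ge0 // ltW.
apply: mx_norm_ler => // i j.
have d1 : `|delta_mx j 0 : 'cV[R]_p| <= 1.
  by apply: mx_norm_ler => // k l; rewrite mxE; case: (_ && _); rewrite ?normr1 ?normr0.
have -> : invmx M i j = (invmx M *m delta_mx j 0 : 'cV[R]_p) i 0 by rewrite -colE mxE.
apply: le_trans (ler_mx_norm _ _ _) _.
apply: le_trans (norm_invmx_mul _ b0 lM) _.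
by rewrite -[leRHS]mulr1 ler_wpM2l.
Qed.

(** The segment from the identity to [M] consists of positive definite matrices, so the determinant
    never vanishes along it; being 1 at the identity, it stays positive by the intermediate value
    theorem. *)
Lemma det_posdef_gt0 p (M : 'M[R]_p) : posdef M -> 0 < \det M.
Proof.
move=> [sM pM].
pose N (r : R) : 'M[R]_p := (1 - r)%:M + r *: M.
have uN r : 0 <= r <= 1 -> \det (N r) != 0.
  move=> /andP[r0 r1]; rewrite -unitfE -unitmxE posdef_unitmx //; split.
    by rewrite /sym linearD /= linearZ /= (sM : _ = _) tr_scalar_mx.
  move=> x x0; rewrite quadD quadZ quad_scalar.
  have [->|rn0] := eqVneq r 0; first by rewrite subr0 mul1r mul0r addr0 dotp_gt0.
  rewrite ltr_wpDl // ?mulr_ge0 ?subr_ge0 ?dotp_ge0 //.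
  by rewrite mulr_gt0 ?pM // lt_def rn0.
have dN r : derivable (fun s => \det (N s)) r 1.
  apply: derivable_det => i j.
  have -> : (fun s => N s i j) =
      (fun s => (1 - s) *+ (i == j)) + (fun s => s * M i j).
    by apply/funext => s; rewrite !mxE.
  apply: derivableD; last first.
    by apply: (@derivableM _ _ id (cst (M i j))).
  case: (i == j); last exact: (derivable_cst 0).
  by rewrite (_ : (fun _ => _) = cst 1 - id) //; exact: derivableB.
rewrite ltNge; apply/negP => d1.
have [|||c] := @IVT R (fun s => \det (N s)) 0 1 0.
- exact: ler01.
- by apply: derivable_within_continuous => s _; exact: dN.
- have -> : N 0 = 1%:M by rewrite /N subr0 scale0r addr0.
  have -> : N 1 = M by rewrite /N subrr scale1r raddf0 add0r.
  by rewrite det1 ge_min le_max d1 ler01 orbT.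
by rewrite in_itv /= => /uN/eqP.
Qed.

End MatrixBounds.

(** * Linear differential equations *)

Section LinearODE.
Context {R : realType}.

Lemma derive_lower_bound (f df : R -> R) (a b c : R) : a <= b ->
  (forall x : R, a <= x <= b -> is_derive x 1 f (df x)) ->
  (forall x, a <= x <= b -> c <= df x) ->
  f a + c * (b - a) <= f b.
Proof.
move=> ab hf hc; have [||x] := @MVT_segment R f df a b ab.
- by move=> x /itvP hx; apply: hf; rewrite !hx.
- apply: derivable_within_continuous => x /itvP hx.
  by apply: ex_derive; apply: hf; rewrite !hx.
- move=> /itvP hx fba; rewrite addrC -lerBrDr fba ler_wpM2r ?subr_ge0 //.
  by apply: hc; rewrite !hx.
Qed.

Lemma is_derive_expM (f : R -> R) (k t df : R) :
  is_derive t 1 f df ->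
  is_derive t 1 (fun s => expR (k * s) * f s) (expR (k * t) * (df + k * f t)).
Proof.
move=> hf.
have hk : is_derive t 1 (fun s => k * s) k.
  apply: is_derive_eq_fun (is_derive_mulr (is_derive_cst k t 1) (is_derive_id t 1)).
    by [].
  by rewrite mul0r add0r mulr1.
have he : is_derive t 1 (fun s => expR (k * s)) (k * expR (k * t)).
  apply: is_derive_eq_fun (is_derive1_comp (is_derive_expR (k * t)) hk) => //.
  by rewrite mulrC.
by apply: is_derive_eq_fun (is_derive_mulr he hf) => //; ring.
Qed.

(** The estimate holds in both time directions: [expR (- L s) f s] is nonincreasing, which settles
    [t <= r], and [expR (L s) f s] is nondecreasing, which settles [r < t]. *)
Lemma gronwall (f df : R -> R) (L t r : R) :
  (forall s : R, is_derive s 1 f (df s)) ->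
  (forall s, `|df s| <= L * f s) ->
  f r <= expR (L * `|r - t|) * f t.
Proof.
move=> hf hL; case: (leP t r) => tr.
- have hg (s : R) : is_derive s (1 : R) (fun u : R => - (expR (- L * u) * f u))
      (- (expR (- L * s) * (df s + - L * f s))).
    exact/is_deriveN/is_derive_expM.
  have := derive_lower_bound tr (fun s _ => hg s) (c := 0).
  rewrite mul0r addr0 lerN2 => h.
  have {}h : expR (- L * r) * f r <= expR (- L * t) * f t.
    apply: h => s _; rewrite oppr_ge0 pmulr_rle0 ?expR_gt0 //.
    by have := hL s; rewrite ler_norml mulNr => /andP[_]; rewrite subr_le0.
  rewrite ger0_norm ?subr_ge0 // -(ler_pM2l (expR_gt0 (- L * r))).
  apply: (le_trans h); rewrite mulrA -expRD le_eqVlt; apply/orP; left.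
  by apply/eqP; congr (expR _ * _); ring.
- have hg s := is_derive_expM L (hf s).
  have := derive_lower_bound (ltW tr) (fun s _ => hg s) (c := 0).
  rewrite mul0r addr0 => h.
  have {}h : expR (L * r) * f r <= expR (L * t) * f t.
    apply: h => s _; rewrite pmulr_rge0 ?expR_gt0 //.
    by have := hL s; rewrite ler_norml => /andP[]; rewrite -subr_ge0 opprK.
  rewrite ltr0_norm ?subr_lt0 // -(ler_pM2l (expR_gt0 (L * r))).
  apply: (le_trans h); rewrite mulrA -expRD le_eqVlt; apply/orP; left.
  by apply/eqP; congr (expR _ * _); ring.
Qed.

Lemma is_derive_col p q (F : R -> 'M[R]_(p, q)) (t : R) dF j :
  is_derive t 1 F dF -> is_derive t 1 (fun r => col j (F r)) (col j dF).
Proof.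
move=> /is_derive_mxP hF; apply/is_derive_mxP => i k.
by apply: is_derive_eq_fun (hF i j) => [r|]; rewrite mxE.
Qed.

Lemma is_derive_dotp p (F G : R -> 'cV[R]_p) (t : R) dF dG :
  is_derive t 1 F dF -> is_derive t 1 G dG ->
  is_derive t 1 (fun r => dotp (F r) (G r)) (dotp dF (G t) + dotp (F t) dG).
Proof.
move=> hF hG; have h := is_derive_mulmx (is_derive_trmx hF) hG.
have /is_derive_mxP/(_ 0 0) := h.
by apply: is_derive_eq_fun => //; rewrite mxE.
Qed.

Lemma dotpC p (x y : 'cV[R]_p) : dotp x y = dotp y x.
Proof. by rewrite !dotpE; apply: eq_bigr => i _; rewrite mulrC. Qed.

Variables (n : nat) (A : R -> 'M[R]_n) (a : R).
Hypothesis Aa : forall t, `|A t| <= a.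

(** The squared length has derivative [2 z^T A z], to which the Gronwall estimate applies; one
    factor [n] comes from the inner product and one from the matrix product. *)
Lemma linear_ode_growth (z : R -> 'cV[R]_n) (r t : R) :
  (forall s : R, is_derive s 1 z (A s *m z s)) ->
  dotp (z r) (z r) <= expR (2 * (n%:R * (n%:R * a)) * `|r - t|) * dotp (z t) (z t).
Proof.
move=> hz; have a0 : 0 <= a by exact: le_trans (Aa 0).
apply: (@gronwall (fun s => dotp (z s) (z s))
  (fun s => dotp (A s *m z s) (z s) + dotp (z s) (A s *m z s))) => s.
  exact: is_derive_dotp.
have -> : dotp (A s *m z s) (z s) + dotp (z s) (A s *m z s) =
    2 * dotp (z s) (A s *m z s) by rewrite dotpC; ring.
rewrite -[2 * _ * _]mulrA normrM (ger0_norm (ler0n _ 2)) ler_wpM2l //.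
apply: le_trans (ler_dotp _ _) _.
rewrite -[leRHS]mulrA ler_wpM2l //.
apply: (@le_trans _ _ (n%:R * a * `|z s| ^+ 2)); last first.
  by rewrite ler_wpM2l ?mulr_ge0 ?norm_sq_le_dotp.
rewrite expr2 mulrCA ler_wpM2l // -mulrA.
exact: mulmx_le.
Qed.

Lemma linear_ode_unique p (Z : R -> 'M[R]_(n, p)) (t : R) :
  (forall s : R, is_derive s 1 Z (A s *m Z s)) -> Z t = 0 -> forall r, Z r = 0.
Proof.
move=> hZ Zt r; apply/matrixP => i j; rewrite mxE.
have hz (s : R) : is_derive s (1 : R) (fun r => col j (Z r)) (A s *m col j (Z s)).
  by apply: is_derive_eq_fun (is_derive_col j (hZ s)) => //; rewrite !colE mulmxA.
have := linear_ode_growth r t hz.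
rewrite Zt (_ : col j 0 = 0); last by apply/matrixP => k l; rewrite !mxE.
rewrite {2}/dotp mulmx0 mxE mulr0 => h.
have z0 : `|col j (Z r)| ^+ 2 <= 0 := le_trans (norm_sq_le_dotp _) h.
have : col j (Z r) = 0.
  by apply/eqP; rewrite -normr_eq0 -sqrf_eq0 eq_le z0 sqr_ge0.
by move/matrixP/(_ i 0); rewrite !mxE.
Qed.

Variable Phi : R -> R -> 'M[R]_n.
Hypothesis hPhi : transition_matrix A Phi.

Lemma transition_matrixK r t : Phi t r *m Phi r t = 1%:M.
Proof.
case: hPhi => Phi1 dPhi.
(* Both terms solve the equation in [s] and agree at [s = r]; uniqueness, read at [s = t], gives the
   inverse relation. *)
pose Z s := Phi s r *m Phi r t - Phi s t.
have hZ (s : R) : is_derive s (1 : R) Z (A s *m Z s).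
  have h := is_derive_mulmx (dPhi s r) (is_derive_cst (Phi r t) s 1).
  apply: is_derive_eq_fun (is_derive_subr h (dPhi s t)) => //.
  by rewrite mulmx0 addr0 mulmxBr mulmxA.
have Zr : Z r = 0 by rewrite /Z Phi1 mul1mx subrr.
by have /eqP := linear_ode_unique hZ Zr t; rewrite subr_eq0 Phi1 => /eqP.
Qed.

Lemma transition_unitmx r t : Phi r t \in unitmx.
Proof. by case/mulmx1_unit: (transition_matrixK r t). Qed.

Lemma transition_inv r t : Phi t r = invmx (Phi r t).
Proof.
by rewrite -[LHS](mulmxK (transition_unitmx r t)) transition_matrixK mul1mx.
Qed.

(** Each column starts from a unit vector and the growth estimate bounds its squared length; taking
    the square root halves the exponent. *)
Lemma transition_growth r t :
  `|Phi r t| <= expR (n%:R * (n%:R * a) * `|r - t|).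
Proof.
case: hPhi => Phi1 dPhi; apply: mx_norm_ler => [|i j]; first exact: expR_ge0.
have hz (s : R) : is_derive s (1 : R) (fun r => col j (Phi r t)) (A s *m col j (Phi s t)).
  by apply: is_derive_eq_fun (is_derive_col j (dPhi s t)) => //; rewrite !colE mulmxA.
have := linear_ode_growth r t hz.
have -> : dotp (col j (Phi t t)) (col j (Phi t t)) = 1.
  rewrite Phi1 dotpE (bigD1 j) //= !mxE eqxx mulr1 big1 ?addr0 // => k kj.
  by rewrite !mxE (negbTE kj) mulr0.
rewrite mulr1 -[2 * _ * _]mulrA expRM_natl => h.
rewrite -ler_sqr ?nnegrE ?expR_ge0 //; apply: le_trans h.
apply: le_trans (norm_sq_le_dotp _); rewrite ler_sqr ?nnegrE //.
by have := ler_mx_norm (col j (Phi r t)) i 0; rewrite mxE.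
Qed.

End LinearODE.

(** * Riccati solutions under uniform controllability *)

Section RiccatiEnergy.
Context {R : realType}.

Lemma dotpDl p (x y z : 'cV[R]_p) : dotp (x + y) z = dotp x z + dotp y z.
Proof. by rewrite /dotp linearD /= mulmxDl mxE. Qed.

Lemma dotpDr p (x y z : 'cV[R]_p) : dotp z (x + y) = dotp z x + dotp z y.
Proof. by rewrite /dotp mulmxDr mxE. Qed.

Lemma dotpNr p (x z : 'cV[R]_p) : dotp z (- x) = - dotp z x.
Proof. by rewrite /dotp mulmxN mxE. Qed.

Lemma dotpMl p q (M : 'M[R]_(p, q)) x (y : 'cV[R]_p) :
  dotp (M *m x) y = dotp x (M^T *m y).
Proof. by rewrite /dotp trmx_mul mulmxA. Qed.

Lemma lq_costE n m (Q : R -> 'M[R]_n) (S : R -> 'M[R]_(n, m)) (W : R -> 'M[R]_m)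
    (t : R) x u :
  lq_cost Q S W t x u =
  dotp x (Q t *m x) + 2 * dotp x (S t *m u) + dotp u (W t *m u).
Proof. by rewrite /lq_cost !quadE /dotp !mulmxA. Qed.

(* The left-hand side is the derivative of [x^T P x] along [x' = A x + B u]. *)
Lemma riccati_completion n m (A : 'M[R]_n) (B : 'M[R]_(n, m))
    (Q : 'M[R]_n) (S : 'M[R]_(n, m)) (W : 'M[R]_m) (P : 'M[R]_n) x u :
  W \in unitmx -> sym W -> sym P ->
  let K := invmx W *m (S^T + B^T *m P) in
  let dP := - (P *m A) - A^T *m P
     + (P *m B + S) *m invmx W *m (B^T *m P + S^T) - Q in
  let dx := A *m x + B *m u in
  dotp dx (P *m x) + dotp x (dP *m x + P *m dx) =
  quad W (u + K *m x) - (dotp x (Q *m x) + 2 * dotp x (S *m u) + dotp u (W *m u)).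
Proof.
(* Here [W K = L], so the square contributes mixed terms through [L] and the term [L^T W^-1 L],
   which is the quadratic term of the Riccati equation. *)
move=> uW sW sP K dP dx; set L := B^T *m P + S^T.
have LT : L^T = P *m B + S by rewrite linearD /= trmx_mul !trmxK sP.
have WK : W *m (K *m x) = L *m x by rewrite /K addrC -mulmxA mulKVmx.
rewrite quadE mulmxDr WK !dotpDl !dotpDr.
have -> : dotp (K *m x) (W *m u) = dotp x (P *m (B *m u)) + dotp x (S *m u).
  by rewrite -[W in LHS]sW -dotpMl WK dotpMl LT mulmxDl dotpDr -mulmxA.
have -> : dotp u (L *m x) = dotp u (B^T *m (P *m x)) + dotp x (S *m u).
  by rewrite mulmxDl dotpDr -mulmxA -(dotpMl S) [dotp (S *m u) x]dotpC.
have -> : dotp (K *m x) (L *m x) = dotp x (L^T *m invmx W *m L *m x).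
  rewrite dotpC dotpMl; congr dotp.
  by rewrite /K -/L [S^T + _]addrC -!mulmxA.
rewrite /dP -LT !mulmxDl !mulmxDr !mulNmx !dotpDr !dotpNr.
by rewrite (dotpMl A) (dotpMl B) !mulmxA; ring.
Qed.

End RiccatiEnergy.

(** * Steering on a window of fixed length with uniform bounds *)

Section RiccatiBound.
Context {R : realType}.
Notation mu := (@lebesgue_measure R).

Lemma continuous_integrable_itv (g : R -> R) (a b : R) :
  continuous g -> mu.-integrable `[a, b] (EFin \o g).
Proof.
move=> cg; apply: continuous_compact_integrable; first exact: segment_compact.
exact: continuous_subspaceT.
Qed.

(* Integrating from t - 1 makes the primitive differentiable at t as well. *)
Lemma primitive_exists (g : R -> R) (t : R) : continuous g ->
  exists G : R -> R, [/\ G t = 0,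
    forall r, t <= r -> is_derive r (1 : R) G (g r) &
    forall r, t <= r -> G r = \int[mu]_(x in `[t, r]) g x].
Proof.
move=> cg; have ig a b := continuous_integrable_itv a b cg.
pose F x := \int[mu]_(y in `[t - 1, x]) g y.
exists (fun r => F r - F t); split; first by rewrite subrr.
- move=> r tr.
  have r1 : t - 1 < r by lra.
  have ru : r < r + 1 by lra.
  have [dF F'] := continuous_FTC1_closed ru (ig _ _) r1 (cg r).
  have hF : is_derive r (1 : R) F (g r) by apply: DeriveDef => //; rewrite -derive1E.
  apply: is_derive_eq_fun (is_derive_subr hF (is_derive_cst (F t) r 1)) => //.
  by rewrite subr0.
- move=> r tr; rewrite /F Rintegral_itvB ?bnd_simp //; last by lra.
  rewrite Rintegral_itv_obnd_cbnd //.
  by apply: integrableS (ig t r) => //; exact: subset_itv_oc_cc.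
Qed.

Lemma primitive_mx_exists p q (g : R -> 'M[R]_(p, q)) (t : R) :
  (forall i j, continuous (fun r => g r i j)) ->
  exists G : R -> 'M[R]_(p, q), [/\ G t = 0,
    forall r, t <= r -> is_derive r (1 : R) G (g r) &
    forall r, t <= r -> G r = mx_integral `[t, r] g].
Proof.
move=> cg; have /choice[G hG] : forall ij : 'I_p * 'I_q, exists G : R -> R, [/\ G t = 0,
    forall r, t <= r -> is_derive r (1 : R) G (g r ij.1 ij.2) &
    forall r, t <= r -> G r = \int[mu]_(x in `[t, r]) g x ij.1 ij.2].
  by move=> ij; exact: primitive_exists.
exists (fun r => \matrix_(i, j) G (i, j) r); split.
- by apply/matrixP => i j; rewrite !mxE; case: (hG (i, j)).
- move=> r tr; apply/is_derive_mxP => i j.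
  case: (hG (i, j)) => _ /(_ r tr) hd _.
  by apply: is_derive_eq_fun hd => // s; rewrite mxE.
- move=> r tr; apply/matrixP => i j; rewrite !mxE.
  by case: (hG (i, j)) => _ _ /(_ r tr).
Qed.

Lemma derive_norm_bound (f df : R -> R) (a b c : R) : a <= b ->
  (forall x : R, a <= x <= b -> is_derive x 1 f (df x)) ->
  (forall x, a <= x <= b -> `|df x| <= c) -> f a = 0 ->
  `|f b| <= c * (b - a).
Proof.
move=> ab hf hc fa0; rewrite ler_norml.
have h1 := derive_lower_bound (c := - c) ab hf.
have h2 := @derive_lower_bound _ (fun x => - f x) (fun x => - df x) a b (- c) ab.
apply/andP; split.
  have : f a + - c * (b - a) <= f b.
    by apply: h1 => x /hc; rewrite ler_norml => /andP[].
  by rewrite fa0 add0r mulNr.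
have : - f a + - c * (b - a) <= - f b.
  apply: h2 => x xab; first by apply: is_deriveN; exact: hf.
  by have := hc x xab; rewrite ler_norml lerN2 => /andP[].
by rewrite fa0 oppr0 add0r mulNr lerN2.
Qed.

Variables (n m : nat) (A : R -> 'M[R]_n) (B : R -> 'M[R]_(n, m)).
Variables (a b : R).
Hypothesis Aa : forall t, `|A t| <= a.
Hypothesis Bb : forall t, `|B t| <= b.
Hypothesis cB : forall t, derivable B t 1.
Hypothesis AB : unif_controllable A B.

(* With [Phi] the transition matrix and [N r] the Gramian on [t, r], the control
   [u = - B^T Phi(t, r)^T eta] produces [x r = Phi(r, t) (xi - N r eta)]. *)
Lemma uniform_steering : exists kappa s : R, [/\ 0 <= kappa, 0 < s &
  forall (t : R) (x0 : 'cV[R]_n),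
    (exists (x : R -> 'cV[R]_n) (u : R -> 'cV[R]_m),
      [/\ forall r, t <= r -> is_derive r (1 : R) x (A r *m x r + B r *m u r),
          forall r, t <= r <= t + s ->
            `|x r| <= kappa * `|x0| /\ `|u r| <= kappa * `|x0|,
          x t = x0 & x (t + s) = 0]) /\
    (exists (x : R -> 'cV[R]_n) (u : R -> 'cV[R]_m),
      [/\ forall r, t <= r -> is_derive r (1 : R) x (A r *m x r + B r *m u r),
          forall r, t <= r <= t + s ->
            `|x r| <= kappa * `|x0| /\ `|u r| <= kappa * `|x0|,
          x t = 0 & x (t + s) = x0])].
Proof.
case: AB => Phi [hPhi [s [beta [s0 beta0 gram]]]].
have a0 : 0 <= a := le_trans (normr_ge0 _) (Aa 0).
have b0 : 0 <= b := le_trans (normr_ge0 _) (Bb 0).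
(* On a window of length [s], [c] bounds the transition matrix, [e] the ratio of [|eta|] to [|x0|],
   [g0] the integrand of the Gramian, and [kx], [ku] the resulting state and control relative to
   [|x0|]. The sum in [e] covers both steering problems at once. *)
pose c := expR (n%:R * (n%:R * a) * s).
have c0 : 0 <= c by exact: expR_ge0.
have Phic r t : `|r - t| <= s -> `|Phi r t| <= c.
  move=> rts; apply: le_trans (transition_growth Aa hPhi r t) _.
  by rewrite ler_expR ler_wpM2l // !mulr_ge0.
pose e := n%:R / beta * (1 + n%:R * c).
have nb0 : 0 <= n%:R / beta by rewrite divr_ge0 // ltW.
have nc0 : 0 <= n%:R * c by rewrite mulr_ge0.
have e0 : 0 <= e by rewrite mulr_ge0 // addr_ge0.
pose g0 := n%:R * (m%:R * (n%:R * (c * b) * b) * c).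
have g00 : 0 <= g0 by rewrite !mulr_ge0.
pose kx := n%:R * (c * (1 + n%:R * (g0 * s * e))).
pose ku := n%:R * (b * (n%:R * (c * e))).
have s00 : 0 <= s by exact: ltW.
have kx0 : 0 <= kx.
  have gse0 : 0 <= g0 * s * e by exact: mulr_ge0 (mulr_ge0 g00 s00) e0.
  by do 2!(apply: mulr_ge0 => //); apply: addr_ge0 => //; exact: mulr_ge0.
have ku0 : 0 <= ku.
  by do 4!(apply: mulr_ge0 => //).
pose g t r := Phi t r *m B r *m (B r)^T *m (Phi t r)^T.
have dg t r : derivable (g t) r 1.
  have hB : is_derive r (1 : R) B ('D_1 B r) by exact/derivableP.
  have hP : is_derive r (1 : R) (Phi t) ('D_1 (Phi t) r).
    (* The differential equation concerns the first argument of [Phi]; differentiability in the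
       second holds because [Phi t r] is the inverse of [Phi r t]. *)
    apply/derivableP; rewrite (_ : Phi t = fun r => invmx (Phi r t)); last first.
      by apply/funext => r'; rewrite -(transition_inv Aa hPhi r' t).
    apply: derivable_invmx => [r'|]; first exact: (transition_unitmx Aa hPhi r' t).
    by case: hPhi => _ dPhi; exact: ex_derive.
  have hPB := is_derive_mulmx hP hB.
  have h1 := is_derive_mulmx (is_derive_mulmx hPB (is_derive_trmx hB)) (is_derive_trmx hP).
  exact: ex_derive.
have gb t r : t <= r <= t + s -> `|g t r| <= g0.
  move=> /andP[tr rs]; have PhiC : `|Phi t r| <= c.
    by apply: Phic; rewrite distrC ger0_norm ?subr_ge0 // lerBlDl.
  by do !apply: mulmx_le; rewrite ?normr_trmx.
(* One formula serves both problems: [xi] is the initial state and [eta] is chosen to reach the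
   prescribed final state. *)
have generic (t : R) (x0 xi eta : 'cV[R]_n) :
    `|xi| <= `|x0| -> `|eta| <= e * `|x0| ->
    exists (x : R -> 'cV[R]_n) (u : R -> 'cV[R]_m),
      [/\ forall r, t <= r -> is_derive r (1 : R) x (A r *m x r + B r *m u r),
          forall r, t <= r <= t + s ->
            `|x r| <= (kx + ku) * `|x0| /\ `|u r| <= (kx + ku) * `|x0|,
          x t = xi &
          x (t + s) = Phi (t + s) t *m (xi - mx_integral `[t, t + s] (g t) *m eta)].
  move=> xix0 etax0.
  have [|N [Nt dN NE]] := @primitive_mx_exists _ _ (g t) t.
    move=> i j r; apply/differentiable_continuous/derivable1_diffP.
    exact: derivable_entry.
  case: (hPhi) => Phi1 dPhi.
  exists (fun r => Phi r t *m (xi - N r *m eta)),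
    (fun r => - ((B r)^T *m ((Phi t r)^T *m eta))); split.
  - move=> r tr.
    have h := is_derive_mulmx (dPhi r t) (is_derive_subr (is_derive_cst xi r 1)
      (is_derive_mulmx (dN r tr) (is_derive_cst eta r 1))).
    apply: is_derive_eq_fun h => //.
    rewrite mulmx0 addr0 sub0r -mulmxA; congr (_ + _).
    rewrite !mulmxN; congr (- _); rewrite /g !mulmxA.
    by rewrite (transition_matrixK Aa hPhi) mul1mx.
  - move=> r rts; have /andP[tr rs] := rts.
    have Nr : `|N r| <= g0 * s.
      apply: mx_norm_ler => [|i j]; first by rewrite mulr_ge0 // ltW.
      apply: (@le_trans _ _ (g0 * (r - t))); last first.
        by rewrite ler_wpM2l // lerBlDl.
      apply: (@derive_norm_bound (fun r => N r i j) (fun r => g t r i j)) => //.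
      + by move=> q /andP[tq _]; have /is_derive_mxP := dN q tq; apply.
      + move=> q /andP[tq qr]; apply: le_trans (ler_mx_norm _ _ _) _.
        by apply: gb; rewrite tq (le_trans qr).
      + by rewrite Nt mxE.
    split.
    + apply: (@le_trans _ _ (kx * `|x0|)); last by rewrite ler_wpM2r // lerDl.
      have -> : kx * `|x0| = n%:R * (c * (`|x0| + n%:R * (g0 * s * (e * `|x0|)))).
        by rewrite /kx; ring.
      apply: le_trans (normr_mulmx _ _) _; rewrite ler_wpM2l // ler_pM //.
        by apply: Phic; rewrite ger0_norm ?subr_ge0 // lerBlDl.
      apply: le_trans (ler_normB _ _) _; rewrite lerD //.
      exact: mulmx_le.
    + apply: (@le_trans _ _ (ku * `|x0|)); last by rewrite ler_wpM2r // lerDr.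
      have -> : ku * `|x0| = n%:R * (b * (n%:R * (c * (e * `|x0|)))) by rewrite /ku; ring.
      rewrite normrN; apply: mulmx_le; first by rewrite normr_trmx.
      apply: mulmx_le => //; rewrite normr_trmx.
      by apply: Phic; rewrite distrC ger0_norm ?subr_ge0 // lerBlDl.
  - by rewrite Phi1 mul1mx Nt mul0mx subr0.
  - by rewrite -NE // lerDl ltW.
exists (kx + ku), s; split=> // [|t x0]; first exact: addr_ge0.
have uG := posdef_unitmx (loewner_gt_posdef (ltW beta0) (gram t)).
split.
(* With [eta] the inverse Gramian applied to [x0], the state is cancelled at time [t + s]. *)
- have [|x [u [dx xu xt xts]]] := generic t x0 x0
      (invmx (mx_integral `[t, t + s] (g t)) *m x0) (lexx _).
    apply: le_trans (norm_invmx_mul _ beta0 (gram t)) _.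
    by rewrite ler_wpM2r // ler_peMr // lerDl.
  by exists x, u; split => //; rewrite xts mulKVmx // subrr mulmx0.
(* Starting from 0, the target [x0] is first transported back to time [t] by [Phi t (t + s)], which
   accounts for the term [n c] in [e]. *)
- have [||x [u [dx xu xt xts]]] := generic t x0 0
      (- (invmx (mx_integral `[t, t + s] (g t)) *m (Phi t (t + s) *m x0))).
  + by rewrite normr0.
  + rewrite normrN; apply: le_trans (norm_invmx_mul _ beta0 (gram t)) _.
    rewrite /e -[leRHS]mulrA ler_wpM2l //.
    apply: (@le_trans _ _ (n%:R * c * `|x0|)); last by rewrite ler_wpM2r // lerDr.
    rewrite -[leRHS]mulrA; apply: mulmx_le => //; apply: Phic.
    by rewrite opprD addNKr normrN ger0_norm // ltW.
  + exists x, u; split => //; rewrite xts sub0r !mulmxN opprK mulKVmx //.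
    by rewrite mulmxA (transition_matrixK Aa hPhi) mul1mx.
Qed.

End RiccatiBound.

(** * Boundedness of symmetric Riccati solutions *)

Section RiccatiBounded.
Context {R : realType}.
Variables (n m : nat) (A : R -> 'M[R]_n) (B : R -> 'M[R]_(n, m)).
Variables (Q : R -> 'M[R]_n) (S : R -> 'M[R]_(n, m)) (W : R -> 'M[R]_m).
Variable P : R -> 'M[R]_n.
Hypotheses (symW : forall t, sym (W t)) (posW : forall t, posdef (W t)).
Hypotheses (symP : forall t, sym (P t)) (ricP : riccati A B Q S W P).

Lemma riccati_energy (t : R) (x : R -> 'cV[R]_n) (u : 'cV[R]_m) :
  is_derive t (1 : R) x (A t *m x t + B t *m u) ->
  is_derive t (1 : R) (fun r => quad (P r) (x r))
    (quad (W t) (u + riccati_gain B S W P t *m x t) - lq_cost Q S W t (x t) u).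
Proof.
move=> dx; have h := is_derive_dotp dx (is_derive_mulmx (ricP t) dx).
apply: is_derive_eq_fun h => [r|]; first by rewrite quadE.
rewrite riccati_completion //; last exact: posdef_unitmx.
by rewrite lq_costE.
Qed.

Lemma ler_lq_cost (q c w X t : R) (x : 'cV[R]_n) (u : 'cV[R]_m) :
  `|Q t| <= q -> `|S t| <= c -> `|W t| <= w -> `|x| <= X -> `|u| <= X ->
  lq_cost Q S W t x u <=
  (n%:R * n%:R * q + 2 * (n%:R * m%:R * c) + m%:R * m%:R * w) * X ^+ 2.
Proof.
move=> Qq Sc Ww xX uX; rewrite lq_costE.
have h1 : dotp x (Q t *m x) <= n%:R * n%:R * q * X ^+ 2.
  apply: le_trans (ler_norm _) _; apply: le_trans (ler_dotp _ _) _.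
  have -> : n%:R * n%:R * q * X ^+ 2 = n%:R * (X * (n%:R * (q * X))) by ring.
  by rewrite ler_wpM2l // ler_pM // mulmx_le.
have h2 : dotp x (S t *m u) <= n%:R * m%:R * c * X ^+ 2.
  apply: le_trans (ler_norm _) _; apply: le_trans (ler_dotp _ _) _.
  have -> : n%:R * m%:R * c * X ^+ 2 = n%:R * (X * (m%:R * (c * X))) by ring.
  by rewrite ler_wpM2l // ler_pM // mulmx_le.
have h3 : dotp u (W t *m u) <= m%:R * m%:R * w * X ^+ 2.
  apply: le_trans (ler_norm _) _; apply: le_trans (ler_dotp _ _) _.
  have -> : m%:R * m%:R * w * X ^+ 2 = m%:R * (X * (m%:R * (w * X))) by ring.
  by rewrite ler_wpM2l // ler_pM // mulmx_le.
by lra.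
Qed.

Variables a b q c w : R.
Hypotheses (Aa : forall t, `|A t| <= a) (Bb : forall t, `|B t| <= b).
Hypotheses (Qq : forall t, `|Q t| <= q) (Sc : forall t, `|S t| <= c).
Hypothesis (Ww : forall t, `|W t| <= w).
Hypotheses (dB : forall t, derivable B t 1) (AB : unif_controllable A B).

Lemma riccati_quad_bound :
  exists2 k : R, 0 <= k & forall t x, `|quad (P t) x| <= k * `|x| ^+ 2.
Proof.
have [kappa [s [kappa0 s0 steer]]] := uniform_steering Aa Bb dB AB.
have q0 := le_trans (normr_ge0 _) (Qq 0).
have c0 := le_trans (normr_ge0 _) (Sc 0).
have w0 := le_trans (normr_ge0 _) (Ww 0).
pose M := n%:R * n%:R * q + 2 * (n%:R * m%:R * c) + m%:R * m%:R * w.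
have M0 : 0 <= M by rewrite !addr_ge0 // !mulr_ge0.
(* The completed square is nonnegative, so [x^T P x] decreases at most at the rate of the cost,
   hence by at most [s M (kappa |x0|)^2] over the window. *)
have decay (t : R) (x0 : 'cV[R]_n) (x : R -> 'cV[R]_n) (u : R -> 'cV[R]_m) :
    (forall r, t <= r -> is_derive r (1 : R) x (A r *m x r + B r *m u r)) ->
    (forall r, t <= r <= t + s ->
       `|x r| <= kappa * `|x0| /\ `|u r| <= kappa * `|x0|) ->
    quad (P t) (x t) - quad (P (t + s)) (x (t + s)) <=
    s * (M * kappa ^+ 2) * `|x0| ^+ 2.
  move=> dx bx; have ts : t <= t + s by rewrite lerDl ltW.
  have := @derive_lower_bound _ (fun r => quad (P r) (x r)) _ t (t + s)
    (- (M * (kappa * `|x0|) ^+ 2)) ts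
    (fun r hr => riccati_energy (dx r (proj1 (andP hr)))).
  have -> : t + s - t = s by ring.
  move=> h; suff : quad (P t) (x t) + - (M * (kappa * `|x0|) ^+ 2) * s <=
    quad (P (t + s)) (x (t + s)).
    by rewrite exprMn => ?; lra.
  apply: h => r hr; have [xb ub] := bx r hr.
  rewrite lerBrDl; have := ler_lq_cost (Qq r) (Sc r) (Ww r) xb ub.
  rewrite -subr_le0 => h; apply: le_trans h _.
  have [_ pW] := posW r; set v := (u r + _).
  by have [->|/pW/ltW//] := eqVneq v 0; rewrite quadE /dotp !mulmx0 mxE.
have k0 : 0 <= s * (M * kappa ^+ 2) by rewrite !mulr_ge0 ?exprn_ge0 // ltW.
have quad0 r : quad (P r) 0 = 0 by rewrite quadE /dotp !mulmx0 mxE.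
exists (s * (M * kappa ^+ 2)) => // t x0; rewrite ler_norml; apply/andP; split.
(* The lower bound at time [t] uses the motion from 0 at [t - s] to [x0] at [t]; the upper bound
   uses the motion from [x0] at [t] to 0 at [t + s]. *)
- have [_ [x [u [dx bx xt xts]]]] := steer (t - s) x0.
  by have := decay _ _ _ _ dx bx; rewrite xt quad0 xts subrK sub0r lerNl.
- have [[x [u [dx bx xt xts]]] _] := steer t x0.
  by have := decay _ _ _ _ dx bx; rewrite xt xts quad0 subr0.
Qed.

Lemma polarization p (M : 'M[R]_p) (x y : 'cV[R]_p) : sym M ->
  2 * dotp x (M *m y) = quad M (x + y) - quad M x - quad M y.
Proof.
move=> sM; rewrite !quadE mulmxDr !dotpDl !dotpDr.
by rewrite [dotp y (M *m x)]dotpC dotpMl sM; ring.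
Qed.

Lemma riccati_bounded : bounded_fun P.
Proof.
have [k k0 Pk] := riccati_quad_bound.
(* An entry of [P t] is a polarized value on basis vectors: the form is at most [4 k] in absolute
   value at [e_i + e_j] and at most [k] at [e_i] and [e_j], and half of the total is [3 k]. *)
apply/bounded_funE; exists (3 * k); first by rewrite mulr_ge0.
move=> t; apply: mx_norm_ler => [|i j]; first by rewrite mulr_ge0.
have d1 l : `|delta_mx l 0 : 'cV[R]_n| <= 1.
  by apply: mx_norm_ler => // i' j'; rewrite mxE; case: (_ && _); rewrite ?normr1 ?normr0.
have bnd x (y : R) : `|x| <= y -> `|quad (P t) x| <= k * y ^+ 2.
  move=> xy; apply: le_trans (Pk t x) _; rewrite ler_wpM2l // ler_sqr ?nnegrE //.
  exact: le_trans xy.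
have h1 := bnd _ _ (d1 i); have h2 := bnd _ _ (d1 j).
have h3 := bnd _ _ (le_trans (ler_normD _ _) (lerD (d1 i) (d1 j))).
have -> : P t i j = dotp (delta_mx i 0) (P t *m delta_mx j 0).
  rewrite -colE dotpE (bigD1 i) //= big1 ?addr0 ?mxE ?eqxx ?mul1r ?mxE // => l li.
  by rewrite !mxE (negbTE li) mul0r.
have := polarization (delta_mx i 0) (delta_mx j 0) (symP t).
move: h1 h2 h3; rewrite !ler_norml => /andP[? ?] /andP[? ?] /andP[? ?] ?.
by apply/andP; split; nra.
Qed.

End RiccatiBounded.

(** * Smoothness *)

Section Smoothness.
Context {R : realType}.

(** Induction runs on finite orders: the derivative of a Riccati solution involves the solution
    itself, so smoothness is gained one order at a time. *)
Definition kderivable (k : nat) p q (F : R -> 'M[R]_(p, q)) : Prop :=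
  forall j : nat, (j < k)%N -> forall t : R, derivable (derive1n j F) t 1.

Lemma smoothE p q (F : R -> 'M[R]_(p, q)) :
  smooth F <-> forall k, kderivable k F.
Proof. by split=> [sF k j _|sF k t]; [exact: sF | exact: (sF k.+1)]. Qed.

Lemma kderivable0 p q (F : R -> 'M[R]_(p, q)) : kderivable 0 F.
Proof. by move=> j; rewrite ltn0. Qed.

(** [derive1n] adds derivatives on the outside, whereas the inductions strip off the innermost one.
    The derivative may then be supplied by an explicit formula. *)
Lemma kderivableS k p q (F : R -> 'M[R]_(p, q)) :
  kderivable k.+1 F <->
  exists2 dF, (forall t : R, is_derive t (1 : R) F (dF t)) & kderivable k dF.
Proof.
split=> [cF|[dF hF cF] [|j] // jk t].
- exists (derive1 F) => [t|j jk t].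
    by rewrite derive1E; apply/derivableP; exact: (cF 0).
  by have := cF j.+1 jk t; rewrite /derive1n iterSr.
- rewrite /derive1n iterSr (_ : derive1 F = dF); first exact: cF.
  by apply/funext => r; rewrite derive1E; case: (hF r).
Qed.

Lemma kderivableW k p q (F : R -> 'M[R]_(p, q)) :
  kderivable k.+1 F -> kderivable k F.
Proof. by move=> cF j jk; apply: cF; exact: ltnW. Qed.

Lemma kderivable_cst k p q (M : 'M[R]_(p, q)) : kderivable k (fun=> M).
Proof.
elim: k M => [|k IHk] M; first by [].
apply/kderivableS; exists (fun=> 0); last exact: IHk.
by move=> t; exact: is_derive_cst.
Qed.

Lemma kderivableD k p q (F G : R -> 'M[R]_(p, q)) :
  kderivable k F -> kderivable k G -> kderivable k (fun t => F t + G t).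
Proof.
elim: k F G => [|k IHk] F G; first by move=> _ _; exact: kderivable0.
move=> /kderivableS[dF hF cF] /kderivableS[dG hG cG].
apply/kderivableS; exists (fun t => dF t + dG t); last exact: IHk.
by move=> t; exact: is_derive_addmx.
Qed.

Lemma kderivableM k p q s (F : R -> 'M[R]_(p, q)) (G : R -> 'M[R]_(q, s)) :
  kderivable k F -> kderivable k G -> kderivable k (fun t => F t *m G t).
Proof.
elim: k F G => [|k IHk] F G; first by move=> _ _; exact: kderivable0.
move=> cF cG.
case/kderivableS: (cF) => dF hF cdF; case/kderivableS: (cG) => dG hG cdG.
apply/kderivableS; exists (fun t => dF t *m G t + F t *m dG t).
  by move=> t; exact: is_derive_mulmx.
exact: kderivableD (IHk _ _ cdF (kderivableW cG)) (IHk _ _ (kderivableW cF) cdG).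
Qed.

Lemma kderivableN k p q (F : R -> 'M[R]_(p, q)) :
  kderivable k F -> kderivable k (fun t => - F t).
Proof.
elim: k F => [|k IHk] F; first by move=> _; exact: kderivable0.
move=> /kderivableS[dF hF cF].
apply/kderivableS; exists (fun t => - dF t); last exact: IHk.
by move=> t; exact: is_deriveN.
Qed.

Lemma kderivable_tr k p q (F : R -> 'M[R]_(p, q)) :
  kderivable k F -> kderivable k (fun t => (F t)^T).
Proof.
elim: k F => [|k IHk] F; first by move=> _; exact: kderivable0.
move=> /kderivableS[dF hF cF].
apply/kderivableS; exists (fun t => (dF t)^T); last exact: IHk.
by move=> t; exact: is_derive_trmx.
Qed.

(** The derivative of the inverse contains the inverse itself, but only at the order already
    reached. *)
Lemma kderivable_invmx k p (M : R -> 'M[R]_p) :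
  (forall t, M t \in unitmx) ->
  kderivable k M -> kderivable k (fun t => invmx (M t)).
Proof.
move=> uM; elim: k => [|k IHk] cM; first exact: kderivable0.
have cV := IHk (kderivableW cM); case/kderivableS: cM => dM hM cM.
apply/kderivableS; exists (fun t => - (invmx (M t) *m dM t *m invmx (M t))).
  by move=> t; exact: is_derive_invmx.
exact: kderivableN (kderivableM (kderivableM cV cM) cV).
Qed.

(** Bootstrap: the right-hand side of the equation is polynomial in [P], [W^-1], the smooth data and
    their transposes, so [k] derivatives of [P] yield [k + 1]. *)
Lemma riccati_smooth n m (A : R -> 'M[R]_n) (B : R -> 'M[R]_(n, m)) Q S W P :
  smooth A -> smooth B -> smooth Q -> smooth S -> smooth W ->
  (forall t, W t \in unitmx) -> riccati A B Q S W P -> smooth P.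
Proof.
move=> /smoothE sA /smoothE sB /smoothE sQ /smoothE sS /smoothE sW uW ricP.
apply/smoothE; elim=> [|k IHk]; first exact: kderivable0.
apply/kderivableS; eexists; first exact: ricP.
have cAT : kderivable k (fun t => (A t)^T) by exact: kderivable_tr.
have cBT : kderivable k (fun t => (B t)^T) by exact: kderivable_tr.
have cST : kderivable k (fun t => (S t)^T) by exact: kderivable_tr.
have cV : kderivable k (fun t => invmx (W t)) by exact: kderivable_invmx.
have cL := kderivableD (kderivableM cBT IHk) cST.
have cLT := kderivableD (kderivableM IHk (sB k)) (sS k).
have cPA := kderivableN (kderivableM IHk (sA k)).
have cAP := kderivableN (kderivableM cAT IHk).
have c3 := kderivableM (kderivableM cLT cV) cL.
exact: kderivableD (kderivableD (kderivableD cPA cAP) c3) (kderivableN (sQ k)).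
Qed.

Lemma riccati_gain_smooth n m (B : R -> 'M[R]_(n, m)) S W P :
  smooth B -> smooth S -> smooth W -> smooth P ->
  (forall t, W t \in unitmx) -> smooth (riccati_gain B S W P).
Proof.
move=> /smoothE sB /smoothE sS /smoothE sW /smoothE sP uW; apply/smoothE => k.
have cBT : kderivable k (fun t => (B t)^T) by exact: kderivable_tr.
have cST : kderivable k (fun t => (S t)^T) by exact: kderivable_tr.
have cV : kderivable k (fun t => invmx (W t)) by exact: kderivable_invmx.
exact: kderivableM cV (kderivableD cST (kderivableM cBT (sP k))).
Qed.

End Smoothness.

(** * Absolutely continuous functions *)

Section AbsolutelyContinuous.
Context {R : realType}.
Notation mu := (@lebesgue_measure R).

(** Absolute continuity in integral form, with density [f]. Trajectories with square-integrable
    controls satisfy their equation in this sense, so the product rule is established for integrals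
    rather than for pointwise derivatives. *)
Definition ac_with (a b : R) (F f : R -> R) : Prop :=
  [/\ mu.-integrable `[a, b] (EFin \o f), {within `[a, b], continuous F} &
      forall t, a <= t <= b -> F t = F a + \int[mu]_(r in `[a, t]) f r].

Lemma integrable_subitv (a b s t : R) (f : R -> R) :
  mu.-integrable `[a, b] (EFin \o f) -> a <= s -> t <= b ->
  mu.-integrable `[s, t] (EFin \o f).
Proof.
move=> fi as_ tb; apply: integrableS fi => //.
by apply: subset_itv; rewrite bnd_simp.
Qed.

Lemma Rintegral_itv_cat (a s t : R) (f : R -> R) :
  mu.-integrable `[a, t] (EFin \o f) -> a <= s -> s <= t ->
  \int[mu]_(r in `[a, t]) f r - \int[mu]_(r in `[a, s]) f r =
  \int[mu]_(r in `[s, t]) f r.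
Proof.
move=> fi as_ st; rewrite Rintegral_itvB ?bnd_simp // Rintegral_itv_obnd_cbnd //.
apply: integrableS (integrable_subitv fi as_ (lexx t)) => //.
exact: subset_itv_oc_cc.
Qed.

Lemma ac_increment (a b s t : R) F f :
  ac_with a b F f -> a <= s -> s <= t -> t <= b ->
  F t - F s = \int[mu]_(r in `[s, t]) f r.
Proof.
move=> [fi _ FE] as_ st tb.
rewrite (FE t) ?(FE s) ?as_ ?tb ?(le_trans as_ st) ?(le_trans st tb) //.
rewrite -(Rintegral_itv_cat _ as_ st); last exact: integrable_subitv fi (lexx a) tb.
by ring.
Qed.

(** An increment is the integral of the density over an interval of small measure. The density is
    extended by zero so that absolute continuity of the integral applies on the whole line. *)
Lemma ac_unif_continuous (a b e : R) F f :
  ac_with a b F f -> 0 < e ->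
  exists2 d : R, 0 < d & forall s t, a <= s -> s <= t -> t <= b -> t - s < d ->
    `|F t - F s| <= e.
Proof.
move=> acF e0; have [fi _ _] := acF.
have intf : mu.-integrable setT (EFin \o (f \_ `[a, b])).
  by rewrite -restrict_EFin; apply/integrable_restrict => //=; rewrite setTI.
have [d [d0 hd]] := integral_normr_continuous intf e0.
exists d => // s t as_ st tb tsd; rewrite (ac_increment acF as_ st tb).
apply: le_trans (le_normr_Rintegral _ _) _ => //.
  exact: integrable_subitv fi as_ tb.
have -> : \int[mu]_(r in `[s, t]) `|f r| = \int[mu]_(r in `[s, t]) `|(f \_ `[a, b]) r|.
  apply: eq_Rintegral => r; rewrite inE /= => rst.
  rewrite patchE ifT // inE /=.
  by apply: subset_itv rst; rewrite bnd_simp.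
apply/ltW/hd => //; rewrite [X in (X < _)%E]lebesgue_measure_itv /= lte_fin.
by case: ifPn => // _; rewrite -EFinD lte_fin.
Qed.

(** The increments of [H] and of [V] both telescope, so the constant [e] does not deteriorate with
    the number of pieces. *)
Lemma chain_increments (a b d e : R) (H V : R -> R) : 0 < d ->
  (forall s t, a <= s -> s <= t -> t <= b -> t - s < d ->
    `|H t - H s| <= e * (V t - V s)) ->
  a <= b -> `|H b - H a| <= e * (V b - V a).
Proof.
move=> d0 small ab.
suff claim (N : nat) (t : R) : a <= t -> t <= b -> t - a < N.+1%:R * d ->
    `|H t - H a| <= e * (V t - V a).
  have /archi_boundP : 0 <= (b - a) / d by rewrite divr_ge0 ?subr_ge0 // ltW.
  rewrite ltr_pdivrMr // => hN; apply: (claim (Num.bound ((b - a) / d))) => //.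
  by apply: (lt_le_trans hN); rewrite ler_pM2r // ler_nat.
elim: N t => [|N IHN] t at_ tb; first by rewrite mul1r; exact: small.
move=> tN; pose k : R := N.+2%:R.
have k0 : 0 < k by rewrite ltr0n.
(* Cutting off the last of [N + 2] equal pieces leaves a piece shorter than [d] and a remainder
   shorter than [(N + 1) d], to which the induction hypothesis applies. *)
pose r := t - (t - a) / k.
have rt : r <= t by rewrite gerBl divr_ge0 ?subr_ge0 // ltW.
have ar : a <= r.
  rewrite /r lerBrDr -lerBrDl ler_pdivrMr // ler_peMr ?subr_ge0 //.
  by rewrite ler1n.
have rd : t - r < d by rewrite /r opprB addrC subrK ltr_pdivrMr // mulrC.
have rN : r - a < N.+1%:R * d.
  have -> : r - a = (t - a) / k * N.+1%:R.
    have -> : N.+1%:R = k - 1 :> R by rewrite /k -[in RHS]natr1 addrK.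
    by rewrite /r; field; rewrite gt_eqF.
  by rewrite mulrC ltr_pM2l ?ltr0n // ltr_pdivrMr // mulrC.
have h1 := IHN r ar (le_trans rt tb) rN.
have h2 := small r t ar rt tb rd.
have -> : H t - H a = (H t - H r) + (H r - H a) by ring.
by apply: le_trans (ler_normD _ _) _; lra.
Qed.

Lemma within_continuous_bounded (a b : R) (F : R -> R) :
  {within `[a, b], continuous F} ->
  measurable_fun `[a, b] F /\ [bounded F x | x in `[a, b]].
Proof.
move=> cF; split; first exact: subspace_continuous_measurable_fun.
have /compact_bounded[M [_ mrt]] := continuous_compact cF (@segment_compact _ a b).
by exists M; split; rewrite ?num_real // => ? ? ? ?; exact: mrt.
Qed.

Lemma integrable_mul_continuous (a b : R) (F g : R -> R) :
  {within `[a, b], continuous F} -> mu.-integrable `[a, b] (EFin \o g) ->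
  mu.-integrable `[a, b] (EFin \o (fun r => F r * g r)).
Proof.
move=> /within_continuous_bounded[mF bF] gi.
apply: (@eq_integrable _ _ _ mu _ _ ((EFin \o F) \* (EFin \o g))%E) => //.
exact: integrableMr.
Qed.

Lemma integrable_addr (a b : R) (f g : R -> R) :
  mu.-integrable `[a, b] (EFin \o f) -> mu.-integrable `[a, b] (EFin \o g) ->
  mu.-integrable `[a, b] (EFin \o (fun r => f r + g r)).
Proof.
move=> fi gi; apply: (@eq_integrable _ _ _ mu _ _ ((EFin \o f) \+ (EFin \o g))%E) => //.
exact: integrableD.
Qed.

End AbsolutelyContinuous.

(** * Sums and products of absolutely continuous functions *)

Section AbsolutelyContinuousProduct.
Context {R : realType}.
Notation mu := (@lebesgue_measure R).

Lemma integrable_scalel (a b k : R) (f : R -> R) :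
  mu.-integrable `[a, b] (EFin \o f) ->
  mu.-integrable `[a, b] (EFin \o (fun r => k * f r)).
Proof.
move=> fi; apply: (@eq_integrable _ _ _ mu _ _ (fun x => k%:E * (EFin \o f) x)%E) => //.
exact: integrableZl.
Qed.

Lemma integrable_normr (a b : R) (f : R -> R) :
  mu.-integrable `[a, b] (EFin \o f) ->
  mu.-integrable `[a, b] (EFin \o (fun r => `|f r|)).
Proof. by move=> fi; exact: integrable_norm. Qed.

(* On a short interval [s, r], replacing G by G r and F by F s in the integrand
   changes its integral by at most e times that of |f| + |g|, and turns it into
   the increment of F G. *)
Lemma ac_mul (a b : R) F f G g :
  ac_with a b F f -> ac_with a b G g ->
  ac_with a b (fun r => F r * G r) (fun r => f r * G r + F r * g r).
Proof.
move=> acF acG; have [fi cF FE] := acF; have [gi cG GE] := acG.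
pose h r := f r * G r + F r * g r.
have hi : mu.-integrable `[a, b] (EFin \o h).
  rewrite (_ : h = fun r => G r * f r + F r * g r).
    by apply: integrable_addr; exact: integrable_mul_continuous.
  by apply/funext => r; rewrite /h mulrC.
split=> //; first by move=> x; apply: continuousM; [exact: cF|exact: cG].
move=> t /andP[at_ tb]; have ab := le_trans at_ tb.
(* [H] is the defect of the product formula; it is shown constant by comparing its increments with
   those of [V]. *)
pose H r := F r * G r - \int[mu]_(x in `[a, r]) h x.
pose v r := `|f r| + `|g r|.
pose V r := \int[mu]_(x in `[a, r]) v x.
have vi : mu.-integrable `[a, b] (EFin \o v).
  by apply: integrable_addr; exact: integrable_normr.
have small e : 0 < e -> exists2 d : R, 0 < d &
    forall s r, a <= s -> s <= r -> r <= b -> r - s < d ->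
    `|H r - H s| <= e * (V r - V s).
  move=> e0; have [d1 d10 h1] := ac_unif_continuous acF e0.
  have [d2 d20 h2] := ac_unif_continuous acG e0.
  exists (Order.min d1 d2) => [|s r as_ sr rb]; first by rewrite lt_min d10.
  rewrite lt_min => /andP[rs1 rs2].
  have ar := le_trans as_ sr.
  have sub k : mu.-integrable `[a, b] (EFin \o k) -> mu.-integrable `[s, r] (EFin \o k).
    by move=> ki; exact: integrable_subitv ki as_ rb.
  have suba k : mu.-integrable `[a, b] (EFin \o k) -> mu.-integrable `[a, r] (EFin \o k).
    by move=> ki; exact: integrable_subitv ki (lexx a) rb.
  rewrite /V (Rintegral_itv_cat (suba _ vi) as_ sr).
  have hE : \int[mu]_(x in `[a, r]) h x =
      \int[mu]_(x in `[s, r]) h x + \int[mu]_(x in `[a, s]) h x.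
    by rewrite -(Rintegral_itv_cat (suba _ hi) as_ sr) subrK.
  pose k x := G r * f x + F s * g x.
  have ki : mu.-integrable `[a, b] (EFin \o k).
    by apply: integrable_addr; exact: integrable_scalel.
  have kE : \int[mu]_(x in `[s, r]) k x = F r * G r - F s * G s.
    rewrite RintegralD //; [|exact/sub/integrable_scalel|exact/sub/integrable_scalel].
    rewrite !RintegralZl //; [|exact: sub|exact: sub].
    rewrite -(ac_increment acF as_ sr rb) -(ac_increment acG as_ sr rb); ring.
  have -> : H r - H s = \int[mu]_(x in `[s, r]) (k x - h x).
    by rewrite RintegralB //; [rewrite kE /H hE; ring|exact: sub|exact: sub].
  have khi : mu.-integrable `[s, r] (EFin \o (fun x => k x - h x)).
    rewrite (_ : (fun _ => _) = fun x => k x + (-1) * h x).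
      by apply: integrable_addr; [exact: sub|exact/integrable_scalel/sub].
    by apply/funext => x; rewrite mulN1r.
  apply: le_trans (le_normr_Rintegral _ khi) _ => //.
  rewrite -RintegralZl //; last exact: sub.
  apply: le_Rintegral => //.
  - exact: integrable_normr.
  - by apply: integrable_scalel; exact: sub.
  - move=> x /=; rewrite in_itv /= => /andP[sx xr].
    have -> : k x - h x = (G r - G x) * f x + (F s - F x) * g x by rewrite /k /h; ring.
    rewrite mulrDr; apply: le_trans (ler_normD _ _) _; rewrite !normrM lerD //.
      rewrite ler_wpM2r //; apply: h2 => //; first exact: le_trans sx.
      by apply: le_lt_trans rs2; rewrite lerB.
    rewrite ler_wpM2r // distrC; apply: h1 => //; first exact: le_trans xr rb.
    by apply: le_lt_trans rs1; rewrite lerB.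
suff Hta : H t = H a.
  move: Hta; rewrite /H set_itv1 Rintegral_set1 subr0 => <-.
  by rewrite -/h subrK.
have V0 : 0 <= V t - V a.
  rewrite /V set_itv1 Rintegral_set1 subr0; apply: Rintegral_ge0 => x _.
  exact: addr_ge0.
apply/eqP; rewrite -subr_eq0 -normr_le0; apply/ler_addgt0Pr => e e0; rewrite add0r.
(* Adding 1 keeps the divisor positive when [V t = V a]; the local tolerance is then scaled so that
   the total error is at most [e]. *)
have C0 : 0 < V t - V a + 1 by rewrite ltr_wpDl.
have [d d0 hd] := small _ (divr_gt0 e0 C0).
apply: (@le_trans _ _ (e / (V t - V a + 1) * (V t - V a))).
  apply: (chain_increments d0) at_ => s r as_ sr rt.
  exact: hd as_ sr (le_trans rt tb).
by rewrite -mulrA ler_piMr ?(ltW e0) // mulrC ler_pdivrMr // mul1r lerDl.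
Qed.

Lemma ac_add (a b : R) F f G g :
  ac_with a b F f -> ac_with a b G g ->
  ac_with a b (fun r => F r + G r) (fun r => f r + g r).
Proof.
move=> [fi cF FE] [gi cG GE]; split; first exact: integrable_addr.
  by move=> x; apply: continuousD; [exact: cF|exact: cG].
move=> t atb; have /andP[at_ tb] := atb; rewrite (FE t atb) (GE t atb).
have fit := integrable_subitv fi (lexx a) tb.
have git := integrable_subitv gi (lexx a) tb.
rewrite (RintegralD _ fit git); first exact: addrACA.
exact: measurable_itv.
Qed.

Lemma ac_zero (a b : R) : ac_with a b (fun=> 0) (fun=> 0).
Proof.
split=> [||t _].
- apply: continuous_integrable_itv; exact: cst_continuous.
- by move=> x; exact: cst_continuous.
- by rewrite add0r /Rintegral integral0.
Qed.

Lemma ac_sum (a b : R) I (s : seq I) (F f : I -> R -> R) :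
  (forall i, ac_with a b (F i) (f i)) ->
  ac_with a b (fun r => \sum_(i <- s) F i r) (fun r => \sum_(i <- s) f i r).
Proof.
move=> acF; elim: s => [|i s IHs].
  have -> : (fun r => \sum_(i <- [::]) F i r) = fun=> 0.
    by apply/funext => r; rewrite big_nil.
  have -> : (fun r => \sum_(i <- [::]) f i r) = fun=> 0.
    by apply/funext => r; rewrite big_nil.
  exact: ac_zero.
have -> : (fun r => \sum_(j <- i :: s) F j r) = fun r => F i r + \sum_(j <- s) F j r.
  by apply/funext => r; rewrite big_cons.
have -> : (fun r => \sum_(j <- i :: s) f j r) = fun r => f i r + \sum_(j <- s) f j r.
  by apply/funext => r; rewrite big_cons.
exact: ac_add.
Qed.

(** Subtracting a primitive of [f] leaves a function with zero derivative on the interval. *)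
Lemma ac_derivable (a b : R) (F f : R -> R) :
  (forall t : R, is_derive t (1 : R) F (f t)) -> continuous f ->
  ac_with a b F f.
Proof.
move=> dF cf; split; first exact: continuous_integrable_itv.
  by apply: continuous_subspaceT => t; exact: is_derive_continuous (dF t).
move=> t /andP[at_ _]; have [G [Ga dG GE]] := primitive_exists a cf.
rewrite -GE //.
have := @derive_norm_bound _ (fun r => F r - F a - G r) (fun r => f r - 0 - f r)
  a t 0 at_.
rewrite mul0r normr_le0 => h; suff /eqP : F t - F a - G t == 0 by lra.
apply: h => [x /andP[ax _]|x _|].
- exact: is_derive_subr (is_derive_subr (dF x) (is_derive_cst _ _ _)) (dG x ax).
- by rewrite subr0 subrr normr0.
- by rewrite Ga subrr subr0.
Qed.

Definition acmx_with (a b : R) p q (F f : R -> 'M[R]_(p, q)) : Prop :=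
  forall i j, ac_with a b (fun r => F r i j) (fun r => f r i j).

Lemma acmx_mul (a b : R) p q s (F f : R -> 'M[R]_(p, q)) (G g : R -> 'M[R]_(q, s)) :
  acmx_with a b F f -> acmx_with a b G g ->
  acmx_with a b (fun r => F r *m G r) (fun r => f r *m G r + F r *m g r).
Proof.
move=> acF acG i j.
have -> : (fun r => (F r *m G r) i j) = fun r => \sum_k F r i k * G r k j.
  by apply/funext => r; rewrite mxE.
have -> : (fun r => (f r *m G r + F r *m g r) i j) =
    fun r => \sum_k (f r i k * G r k j + F r i k * g r k j).
  by apply/funext => r; rewrite !mxE big_split.
by apply: ac_sum => k; exact: ac_mul.
Qed.

Lemma acmx_tr (a b : R) p q (F f : R -> 'M[R]_(p, q)) :
  acmx_with a b F f -> acmx_with a b (fun r => (F r)^T) (fun r => (f r)^T).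
Proof.
move=> acF i j.
have -> : (fun r => (F r)^T i j) = fun r => F r j i by apply/funext => r; rewrite mxE.
have -> : (fun r => (f r)^T i j) = fun r => f r j i by apply/funext => r; rewrite mxE.
exact: acF.
Qed.

End AbsolutelyContinuousProduct.

(** * Cost integrals *)

Section CostIntegral.
Context {R : realType}.
Notation mu := (@lebesgue_measure R).

Lemma integrable_sumr (a b : R) I (s : seq I) (f : I -> R -> R) :
  (forall i, mu.-integrable `[a, b] (EFin \o f i)) ->
  mu.-integrable `[a, b] (EFin \o (fun r => \sum_(i <- s) f i r)).
Proof.
move=> fi; elim: s => [|i s IHs].
  have -> : (fun r => \sum_(i <- [::]) f i r) = fun=> 0.
    by apply/funext => r; rewrite big_nil.
  by have [] := ac_zero a b.
have -> : (fun r => \sum_(j <- i :: s) f j r) = fun r => f i r + \sum_(j <- s) f j r.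
  by apply/funext => r; rewrite big_cons.
exact: integrable_addr.
Qed.

Definition mx_integrable (a b : R) p q (F : R -> 'M[R]_(p, q)) : Prop :=
  forall i j, mu.-integrable `[a, b] (EFin \o (fun r => F r i j)).

Definition mx_continuous (a b : R) p q (F : R -> 'M[R]_(p, q)) : Prop :=
  forall i j, {within `[a, b], continuous (fun r => F r i j)}.

Lemma mx_integrable_mul (a b : R) p q s (C : R -> 'M[R]_(p, q)) (F : R -> 'M[R]_(q, s)) :
  mx_continuous a b C -> mx_integrable a b F ->
  mx_integrable a b (fun r => C r *m F r).
Proof.
move=> cC iF i j.
have -> : (fun r => (C r *m F r) i j) = fun r => \sum_k C r i k * F r k j.
  by apply/funext => r; rewrite mxE.
by apply: integrable_sumr => k; exact: integrable_mul_continuous.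
Qed.

Lemma mx_continuous_integrable (a b : R) p q (F : R -> 'M[R]_(p, q)) :
  mx_continuous a b F -> mx_integrable a b F.
Proof.
move=> cF i j; apply: continuous_compact_integrable; first exact: segment_compact.
exact: cF.
Qed.

Lemma mx_continuous_tr (a b : R) p q (F : R -> 'M[R]_(p, q)) :
  mx_continuous a b F -> mx_continuous a b (fun r => (F r)^T).
Proof.
move=> cF i j.
have -> : (fun r => (F r)^T i j) = fun r => F r j i by apply/funext => r; rewrite mxE.
exact: cF.
Qed.

Lemma derivable_mx_continuous (a b : R) p q (F : R -> 'M[R]_(p, q)) :
  (forall t, derivable F t 1) -> mx_continuous a b F.
Proof.
move=> dF i j; apply: continuous_subspaceT => t.
apply/differentiable_continuous/derivable1_diffP; exact: derivable_entry.
Qed.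

Lemma smooth_derivable p q (F : R -> 'M[R]_(p, q)) t :
  smooth F -> derivable F t 1.
Proof. by move=> sF; exact: (sF 0). Qed.

(** The product is dominated by [u_i^2 + u_j^2]. *)
Lemma square_integrable_mul n (a b : R) (u : R -> 'cV[R]_n) i j :
  square_integrable a b u ->
  mu.-integrable `[a, b] (EFin \o (fun r => u r i 0 * u r j 0)).
Proof.
move=> hu; have [mi ii] := hu i; have [mj ij] := hu j.
apply: (le_integrable _ _ _ (integrable_addr ii ij)) => //.
  by apply/measurable_EFinP; exact: measurable_funM.
move=> r _ /=; rewrite lee_fin.
rewrite [leRHS]ger0_norm ?addr_ge0 ?sqr_ge0 // ler_norml.
by apply/andP; split; nra.
Qed.

(** Constants are integrable on a bounded interval, and [|u_i| <= 1 + u_i^2]. *)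
Lemma square_integrable_integrable n (a b : R) (u : R -> 'cV[R]_n) :
  square_integrable a b u -> mx_integrable a b u.
Proof.
move=> hu i j; rewrite (ord1 j); have [mi ii] := hu i.
have i1 : mu.-integrable `[a, b] (EFin \o (fun=> 1 : R)).
  by apply: continuous_integrable_itv; exact: cst_continuous.
apply: (le_integrable _ _ _ (integrable_addr i1 ii)) => //.
  exact/measurable_EFinP.
move=> r _ /=; rewrite lee_fin.
rewrite [leRHS]ger0_norm ?addr_ge0 ?sqr_ge0 // ler_norml.
by apply/andP; split; nra.
Qed.

Variables (n m : nat) (A : R -> 'M[R]_n) (B : R -> 'M[R]_(n, m)).
Variables (Q : R -> 'M[R]_n) (S : R -> 'M[R]_(n, m)) (W : R -> 'M[R]_m).
Hypotheses (sA : smooth A) (sB : smooth B).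
Hypotheses (sQ : smooth Q) (sS : smooth S) (sW : smooth W).

Lemma trajectory_continuous (a b : R) x u :
  trajectory A B a b x u -> mx_continuous a b x.
Proof.
case=> _ cx _ i j r.
exact: (cvg_comp _ _ (cx r) (@coord_continuous _ _ _ i j (x r))).
Qed.

Lemma trajectory_ac (a b : R) x u :
  trajectory A B a b x u -> acmx_with a b x (fun r => A r *m x r + B r *m u r).
Proof.
move=> tr; have cx := trajectory_continuous tr; have [hu _ xE] := tr => i j.
split.
- have -> : (fun r => (A r *m x r + B r *m u r) i j) =
      fun r => (A r *m x r) i j + (B r *m u r) i j.
    by apply/funext => r; rewrite mxE.
  apply: integrable_addr; apply: mx_integrable_mul.
  + by apply: derivable_mx_continuous => t; exact: smooth_derivable.
  + exact: mx_continuous_integrable.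
  + by apply: derivable_mx_continuous => t; exact: smooth_derivable.
  + exact: square_integrable_integrable.
- exact: cx.
- by move=> t tab; rewrite (xE t tab) !mxE.
Qed.

Lemma lq_cost_integrable (a b : R) x u :
  trajectory A B a b x u ->
  mu.-integrable `[a, b] (EFin \o (fun r => lq_cost Q S W r (x r) (u r))).
Proof.
move=> tr; have cx := trajectory_continuous tr; have [hu _ _] := tr.
have iu := square_integrable_integrable hu.
have ix := mx_continuous_integrable cx.
have cQ : mx_continuous a b Q.
  by apply: derivable_mx_continuous => t; exact: smooth_derivable.
have cS : mx_continuous a b S.
  by apply: derivable_mx_continuous => t; exact: smooth_derivable.
have cW : mx_continuous a b W.
  by apply: derivable_mx_continuous => t; exact: smooth_derivable.
(* As [u] is only square-integrable, its quadratic term is split into products [u_i u_j] with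
   continuous coefficients; in the other terms continuous factors multiply an integrable one. *)
have -> : (fun r => lq_cost Q S W r (x r) (u r)) = fun r =>
    (((x r)^T *m (Q r *m x r)) 0 0 + 2 * ((x r)^T *m (S r *m u r)) 0 0) +
    \sum_i \sum_j W r i j * (u r i 0 * u r j 0).
  apply/funext => r; rewrite lq_costE; congr (_ + _).
  rewrite dotpE; apply: eq_bigr => i _; rewrite mxE mulr_sumr.
  by apply: eq_bigr => j _; ring.
apply: integrable_addr; first apply: integrable_addr.
- exact: mx_integrable_mul (mx_continuous_tr cx) (mx_integrable_mul cQ ix) 0 0.
- apply: integrable_scalel.
  exact: mx_integrable_mul (mx_continuous_tr cx) (mx_integrable_mul cS iu) 0 0.
- apply: integrable_sumr => i; apply: integrable_sumr => j.
  by apply: integrable_mul_continuous; [exact: cW|exact: square_integrable_mul].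
Qed.

Variable P : R -> 'M[R]_n.
Hypotheses (symW : forall t, sym (W t)) (posW : forall t, posdef (W t)).
Hypotheses (symP : forall t, sym (P t)) (ricP : riccati A B Q S W P).
Hypothesis sP : smooth P.

(** The product rule for absolutely continuous functions applies to [x^T P x], whose density is the
    completed square minus the cost. The factor [k] anticipates the normalization of the
    determinant. *)
Lemma cost_integral_completion (a b k : R) x u : a <= b ->
  trajectory A B a b x u ->
  cost_integral (canonical_cost (riccati_gain B S W P) (fun t => k *: W t)) a b x u =
  k * (cost_integral (lq_cost Q S W) a b x u + (quad (P b) (x b) - quad (P a) (x a))).
Proof.
move=> ab tr; have acx := trajectory_ac tr.
pose dP (t : R) := - (P t *m A t) - (A t)^T *m P t
     + (P t *m B t + S t) *m invmx (W t) *m ((B t)^T *m P t + (S t)^T) - Q t.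
have acP : acmx_with a b P dP.
  move=> i j; apply: ac_derivable => [t|].
    by have /is_derive_mxP := ricP t; apply.
  have -> : dP = derive1 P.
    by apply/funext => t; rewrite derive1E; case: (ricP t).
  move=> t; apply/differentiable_continuous/derivable1_diffP.
  (* The first derivative of [P] is itself derivable, hence continuous, as [ac_derivable] requires
     of the density. *)
  exact: (@derivable_entry _ _ _ _ _ i j (@sP 1%N t)).
have acE := acmx_mul (acmx_tr acx) (acmx_mul acP acx).
have {acE} [ei _ eE] := acE 0 0.
pose e r := quad (W r) (u r + riccati_gain B S W P r *m x r) -
  lq_cost Q S W r (x r) (u r).
have eF : (fun r => ((A r *m x r + B r *m u r)^T *m (P r *m x r) +
    (x r)^T *m (dP r *m x r + P r *m (A r *m x r + B r *m u r))) 0 0) = e.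
  apply/funext => r; rewrite mxE /e lq_costE.
  have uW := posdef_unitmx (posW r).
  by have := riccati_completion (A r) (B r) (Q r) (S r) (x r) (u r) uW (symW r) (symP r).
rewrite eF in ei eE.
have li := lq_cost_integrable tr.
have wE : \int[mu]_(r in `[a, b]) quad (W r) (u r + riccati_gain B S W P r *m x r) =
    \int[mu]_(r in `[a, b]) e r + cost_integral (lq_cost Q S W) a b x u.
  rewrite /cost_integral -RintegralD //; apply: eq_Rintegral => r _.
  by rewrite /e subrK.
have wi : mu.-integrable `[a, b]
    (EFin \o (fun r => quad (W r) (u r + riccati_gain B S W P r *m x r))).
  have -> : (fun r => quad (W r) (u r + riccati_gain B S W P r *m x r)) =
      fun r => e r + lq_cost Q S W r (x r) (u r).
    by apply/funext => r; rewrite /e subrK.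
  exact: integrable_addr.
have -> : cost_integral (canonical_cost (riccati_gain B S W P) (fun t => k *: W t))
    a b x u = k * \int[mu]_(r in `[a, b]) quad (W r) (u r + riccati_gain B S W P r *m x r).
  rewrite -RintegralZl //; apply: eq_Rintegral => r _.
  by rewrite /canonical_cost quadZ.
rewrite wE; congr (_ * _); rewrite addrC; congr (_ + _).
have := eE b; rewrite ab lexx => /(_ isT) h.
by rewrite !quadE /dotp h addrC addKr.
Qed.

End CostIntegral.

(** * Canonical costs *)

Section Normalization.
Context {R : realType}.

Lemma posdefZ p (k : R) (M : 'M[R]_p) : 0 < k -> posdef M -> posdef (k *: M).
Proof.
move=> k0 [sM pM]; split; first by rewrite /sym linearZ /= (sM : _ = _).
by move=> x x0; rewrite quadZ mulr_gt0 // pM.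
Qed.

Lemma unif_posdef_posdef p (W : R -> 'M[R]_p) t : unif_posdef W -> posdef (W t).
Proof. by case=> k k0 Wk; exact: loewner_gt_posdef (ltW k0) (Wk t). Qed.

Lemma unif_posdefZ p (k : R) (W : R -> 'M[R]_p) :
  0 < k -> unif_posdef W -> unif_posdef (fun t => k *: W t).
Proof.
move=> k0 [c c0 Wc]; exists (k * c); first exact: mulr_gt0.
move=> t; rewrite /loewner_gt -scale_scalar_mx -scalerBr.
exact: posdefZ k0 (Wc t).
Qed.

Lemma smoothZ p q (k : R) (F : R -> 'M[R]_(p, q)) :
  smooth F -> smooth (fun t => k *: F t).
Proof.
move=> /smoothE sF; apply/smoothE => j.
have -> : (fun t => k *: F t) = fun t => k%:M *m F t.
  by apply/funext => t; rewrite mul_scalar_mx.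
by apply: kderivableM (sF j); exact: kderivable_cst.
Qed.

(** The factor is the [p]-th root of the inverse determinant, written with exponential and
    logarithm. For [p = 0] the determinant of the empty matrix is already 1. *)
Lemma det_normalization p (M : 'M[R]_p) :
  posdef M -> exists2 k : R, 0 < k & \det (k *: M) = 1.
Proof.
move=> pM; have d0 := det_posdef_gt0 pM.
exists (expR (- ln (\det M) / p%:R)); first exact: expR_gt0.
rewrite detZ -expRM_natl; case: p M pM d0 => [|p] M pM d0.
  by rewrite mul0r expR0 mul1r det_mx00.
by rewrite [p.+1%:R * _]mulrC divfK ?pnatr_eq0 // expRN lnK ?posrE // mulVf // gt_eqF.
Qed.

End Normalization.

(** * The stabilizing solution of a canonical cost *)

Section CanonicalCost.
Context {R : realType}.
Variables (n m : nat) (A : R -> 'M[R]_n) (B : R -> 'M[R]_(n, m)).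
Variables (K : R -> 'M[R]_(m, n)) (W : R -> 'M[R]_m).
Hypothesis hAB : standing_assumptions A B.
Hypothesis hKW : canonical_pair A B K W.

Let uW t : W t \in unitmx.
Proof. exact: posdef_unitmx (unif_posdef_posdef t (canonical_W_unif_posdef hKW)). Qed.

Let symW t : (W t)^T = W t.
Proof. exact: canonical_W_sym hKW t. Qed.

Lemma canonical_S_tr t : (canonical_S K W t)^T = W t *m K t.
Proof. by rewrite /canonical_S trmx_mul trmxK symW. Qed.

Lemma canonical_gain : riccati_gain B (canonical_S K W) W (fun=> 0) = K.
Proof.
by apply/funext => t; rewrite /riccati_gain canonical_S_tr mulmx0 addr0 mulKmx.
Qed.

Lemma canonical_closed_loop :
  closed_loop A B (canonical_S K W) W (fun=> 0) = fun t => A t - B t *m K t.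
Proof. by apply/funext => t; rewrite /closed_loop canonical_gain. Qed.

(** At [P = 0] the equation reduces to [S W^-1 S^T = Q], and both sides equal [K^T W K]. *)
Lemma canonical_stabilizing_zero :
  stabilizing_solution A B (canonical_Q K W) (canonical_S K W) W (fun=> 0).
Proof.
split.
- by move=> t; rewrite /sym trmx0.
- move=> t; apply: is_derive_eq_fun (is_derive_cst 0 t 1) => //.
  rewrite canonical_S_tr !mul0mx !mulmx0 !oppr0 !add0r /canonical_S /canonical_Q.
  by rewrite mulmxK // mulmxA subrr.
- by rewrite canonical_closed_loop; exact: canonical_stable hKW.
Qed.

(** Comparing the Riccati equations of 0 and [P] turns the quadratic term into a bilinear one:
    [A_1^T P + P' + P A_2 = 0], where [A_1] and [A_2] are the closed loops of 0 and [P]. This makes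
    the conjugation of [P] by the two flows constant. *)
Lemma canonical_riccati_conjugate (P : R -> 'M[R]_n) t :
  (A t - B t *m K t)^T *m P t +
  (- (P t *m A t) - (A t)^T *m P t
     + (P t *m B t + canonical_S K W t) *m invmx (W t) *m
       ((B t)^T *m P t + (canonical_S K W t)^T) - canonical_Q K W t) +
  P t *m closed_loop A B (canonical_S K W) W P t = 0.
Proof.
rewrite /closed_loop /riccati_gain canonical_S_tr.
rewrite [W t *m K t + _]addrC; set L := (B t)^T *m P t + W t *m K t.
rewrite [(P t *m B t + _) *m _]mulmxDl /canonical_S mulmxK // mulmxDl.
rewrite /canonical_Q -!mulmxA.
have -> : (K t)^T *m L = (K t)^T *m ((B t)^T *m P t) + (K t)^T *m (W t *m K t).
  by rewrite mulmxDr.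
rewrite linearB /= trmx_mul mulmxBl mulmxBr -!mulmxA.
set X := P t *m (B t *m _); set Y := (A t)^T *m P t; set Z := P t *m A t.
set U := (K t)^T *m ((B t)^T *m P t); set V := (K t)^T *m (W t *m K t).
by apply/matrixP => i j; rewrite !mxE; ring.
Qed.

Lemma canonical_stabilizing_unique (P : R -> 'M[R]_n) :
  stabilizing_solution A B (canonical_Q K W) (canonical_S K W) W P ->
  P = fun=> 0.
Proof.
case=> symP ricP [Phi2 [hPhi2 [a2 [b2 [a20 b20 Phi2b]]]]].
have [Phi1 [hPhi1 [a1 [b1 [a10 b10 Phi1b]]]]] := canonical_stable hKW.
have posW t := unif_posdef_posdef t (canonical_W_unif_posdef hKW).
have /bounded_funE[a _ Aa] := A_bounded hAB.
have /bounded_funE[b _ Bb] := B_bounded hAB.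
have /bounded_funE[w _ Ww] := canonical_W_bounded hKW.
have /bounded_funE[k _ Kk] := canonical_K_bounded hKW.
have KTk t : `|(K t)^T| <= k by rewrite normr_trmx.
have Sb t : `|canonical_S K W t| <= m%:R * (k * w) by exact: mulmx_le.
have Qb t : `|canonical_Q K W t| <= m%:R * (m%:R * (k * w) * k).
  exact: mulmx_le (Sb t) (Kk t).
have dB (t : R) : derivable B t 1 by exact: smooth_derivable (B_smooth hAB).
(* Boundedness of [P] is not part of being stabilizing; it is derived from uniform controllability,
   applied to the canonical cost. *)
have /bounded_funE[c c0 Pc] := riccati_bounded symW posW symP ricP Aa Bb Qb Sb Ww dB
  (AB_unif_controllable hAB).
have [Phi11 dPhi1] := hPhi1; have [Phi21 dPhi2] := hPhi2.
have Z_cst s t : (Phi1 t s)^T *m (P t *m Phi2 t s) = P s.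
  have dZ (r : R) : is_derive r (1 : R)
      (fun r => (Phi1 r s)^T *m (P r *m Phi2 r s)) 0.
    have h := is_derive_mulmx (is_derive_trmx (dPhi1 r s))
      (is_derive_mulmx (ricP r) (dPhi2 r s)).
    apply: is_derive_eq_fun h => //.
    have conj (X M D N Y T : 'M[R]_n) : X *m M *m (Y *m T) +
        X *m (D *m T + Y *m (N *m T)) = X *m ((M *m Y + D + Y *m N) *m T).
      by rewrite !mulmxDl !mulmxDr !mulmxA addrA.
    by rewrite trmx_mul conj canonical_riccati_conjugate mul0mx mulmx0.
  apply/matrixP => i j.
  have -> : P s i j = ((Phi1 s s)^T *m (P s *m Phi2 s s)) i j.
    by rewrite Phi11 Phi21 trmx1 mul1mx mulmx1.
  apply: (is_derive_0_is_cst (f := fun r => ((Phi1 r s)^T *m (P r *m Phi2 r s)) i j)).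
  move=> r; have /is_derive_mxP/(_ i j) := dZ r.
  by rewrite mxE.
apply/funext => s; apply/eqP; rewrite -normr_le0.
pose C := n%:R * (a1 * (n%:R * (c * a2))).
have C0 : 0 <= C by rewrite !mulr_ge0 // ltW.
(* The factor [Phi1] supplies the exponential decay, while [P] and [Phi2] contribute the constants
   [c] and [a2]. *)
have decay t : s <= t -> `|P s| <= C * expR (- b1 * (t - s)).
  move=> st; rewrite -(Z_cst s t).
  have h1 : `|(Phi1 t s)^T| <= a1 * expR (- b1 * (t - s)).
    by rewrite normr_trmx; exact: Phi1b.
  have h2 : `|Phi2 t s| <= a2.
    apply: le_trans (Phi2b _ _ st) _; rewrite ler_piMr ?(ltW a20) // -expR0 ler_expR.
    by rewrite mulNr oppr_le0 mulr_ge0 ?subr_ge0 // ltW.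
  apply: le_trans (mulmx_le h1 (mulmx_le (Pc t) h2)) _.
  by rewrite le_eqVlt; apply/orP; left; apply/eqP; rewrite /C; ring.
apply/ler_addgt0Pr => e e0; rewrite add0r.
(* This time makes the exponent equal to [- (C / e)], and [C expR (- (C / e)) <= e] follows from
   [1 + x <= expR x]. *)
pose t := s + C / e / b1.
have st : s <= t by rewrite lerDl !divr_ge0 // ltW.
apply: le_trans (decay t st) _.
have -> : - b1 * (t - s) = - (C / e).
  by rewrite /t; field; rewrite !gt_eqF.
rewrite expRN ler_pdivrMr ?expR_gt0 //.
apply: (@le_trans _ _ (e * (1 + C / e))); last first.
  by rewrite ler_pM2l // expR_ge1Dx.
by rewrite mulrDr mulr1 mulrC divfK ?gt_eqF // lerDr ltW.
Qed.

Lemma canonical_P_plus :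
  is_P_plus A B (canonical_Q K W) (canonical_S K W) W (fun=> 0).
Proof.
split; first exact: canonical_stabilizing_zero.
by move=> P /canonical_stabilizing_unique.
Qed.

End CanonicalCost.

(** * Equivalence of a quadratic cost with a canonical one *)

Theorem proposition2p10 (R : realType) (n m : nat)
  (A : R -> 'M[R]_n) (B : R -> 'M[R]_(n, m))
  (hAB : standing_assumptions A B)
  (Q : R -> 'M[R]_n) (S : R -> 'M[R]_(n, m)) (W : R -> 'M[R]_m)
  (hc : C_LQ Q S W)
  (hP : exists P : R -> 'M[R]_n, stabilizing_solution A B Q S W P) :
  exists (K : R -> 'M[R]_(m, n)) (W' : R -> 'M[R]_m),
    [/\ canonical_pair A B K W',
        equivalent_costs A B (lq_cost Q S W) (canonical_cost K W') &
        exists P' : R -> 'M[R]_n,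
          [/\ is_P_plus A B (canonical_Q K W') (canonical_S K W') W' P',
              riccati_gain B (canonical_S K W') W' P' = K &
              closed_loop A B (canonical_S K W') W' P' = (fun t => A t - B t *m K t)]].
Proof.
case: hP => P [symP ricP stabP].
have [sA sB] := (A_smooth hAB, B_smooth hAB).
have [[sQ sS] sW] := (Q_smooth hc, S_smooth hc, W_smooth hc).
have symW := W_sym hc.
have posW t := unif_posdef_posdef t (W_unif_posdef hc).
have uW t := posdef_unitmx (posW t).
have sP : smooth P := riccati_smooth sA sB sQ sS sW uW ricP.
(* The determinant is prescribed at time 0 only, so one positive constant rescales [W] at all
   times. *)
have [k k0 detk] := det_normalization (posW 0).
pose K := riccati_gain B S W P; pose W' t := k *: W t.
have hKW : canonical_pair A B K W'.
  have /bounded_funE[a _ Aa] := A_bounded hAB.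
  have /bounded_funE[b _ Bb] := B_bounded hAB.
  have /bounded_funE[q _ Qq] := Q_bounded hc.
  have /bounded_funE[c _ Sc] := S_bounded hc.
  have /bounded_funE[w w0 Ww] := W_bounded hc.
  have dB (t : R) : derivable B t 1 by exact: smooth_derivable.
  have /bounded_funE[p p0 Pp] := riccati_bounded symW posW symP ricP Aa Bb Qq Sc Ww dB
    (AB_unif_controllable hAB).
  split => //.
  - by move=> t; rewrite /sym linearZ /= (symW t : _ = _).
  - exact: smoothZ.
  - apply/bounded_funE; exists (k * w) => [|t]; first by rewrite mulr_ge0 // ltW.
    by rewrite normrZ gtr0_norm // ler_pM2l.
  - exact: unif_posdefZ (W_unif_posdef hc).
  - exact: riccati_gain_smooth.
  - have [r r0 Wr] := W_unif_posdef hc.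
    (* Here [m / r] bounds [W^-1], and [c + n b p] bounds [S^T + B^T P]. *)
    have Kb t : `|K t| <= m%:R * (m%:R / r * (c + n%:R * (b * p))).
      apply: mulmx_le; first exact: norm_invmx.
      apply: le_trans (ler_normD _ _) _; rewrite normr_trmx lerD //.
      by apply: mulmx_le => //; rewrite normr_trmx.
    by apply/bounded_funE; eexists; [exact: le_trans (normr_ge0 _) (Kb 0) | exact: Kb].
exists K, W'; split => //; last first.
  (* The solution [P] of the original equation has supplied [K]; the stabilizing solution of the
     canonical cost itself is 0. *)
  exists (fun=> 0); split.
  - exact: canonical_P_plus.
  - exact: canonical_gain hKW.
  - exact: canonical_closed_loop hKW.
(* Between fixed end points the canonical cost is an increasing affine function of the original one,
   so the same controls minimize both. *)
have costE a b x u : a < b -> trajectory A B a b x u ->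
    cost_integral (canonical_cost K W') a b x u =
    k * (cost_integral (lq_cost Q S W) a b x u + (quad (P b) (x b) - quad (P a) (x a))).
  by move=> /ltW ab; exact: cost_integral_completion.
apply/seteqP; split=> -[[a b] x] [/= ab [u [tr minu]]]; split=> //=;
  exists u; split=> // y v tr' ya yb.
- rewrite !costE // ya yb ler_pM2l // lerD2r.
  exact: minu.
- have := minu y v tr' ya yb.
  by rewrite !costE // ya yb ler_pM2l // lerD2r.
Qed.
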